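(* The Maximum Edge Open Packing problem on chordal graphs can be solved in FPT time when parameterized by the clique number; that is, there are a computable function $f$, a polynomial $q$ and an algorithm which, given any chordal graph $G$ on $n$ vertices with clique number $\omega$, computes the edge open packing number $\rho_e^o(G)$ in time at most $f(\omega)\cdot q(n)$.
   Context: Graphs are finite, simple and undirected. Two distinct edges $e_1,e_2$ of a graph $G=(V,E)$ are said to conflict (to have a common edge) if there is an edge $e\in E\setminus\{e_1,e_2\}$ joining an endpoint of $e_1$ to an endpoint of $e_2$. A set $D\subseteq E$ is an edge open packing set of $G$ if no two distinct edges of $D$ conflict. The edge open packing number $\rho_e^o(G)$ is the maximum cardinality of an edge open packing set of $G$. The Maximum Edge Open Packing problem is: given a graph $G$, determine $\rho_e^o(G)$. A graph is chordal if it has no induced cycle of length at least four. The clique number of $G$ is the maximum size of a clique in $G$. *)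

(* Defs.v *)
From mathcomp Require Import all_boot all_algebra.

Set Implicit Arguments.
Unset Strict Implicit.
Unset Printing Implicit Defensive.

(* A simple graph on the finite vertex type T is given by its adjacency
   relation e, assumed symmetric and irreflexive where it is used; its edges
   are the two-element sets [set x; y] with e x y. *)
Section Graphs.
Variables (T : finType) (e : rel T).

Definition edges : {set {set T}} :=
  [set a : {set T} | [exists x, exists y, e x y && (a == [set x; y])]].

Definition conflict (a b : {set T}) : bool :=
  [exists c in edges :\: [set a; b],
     exists x in a, exists y in b, c == [set x; y]].

Definition edge_open_packing (D : {set {set T}}) : bool :=
  (D \subset edges) &&
  [forall a in D, forall b in D, (a != b) ==> ~~ conflict a b].

Definition eop_number : nat :=
  \max_(D : {set {set T}} | edge_open_packing D) #|D|.

Definition clique (K : {set T}) : bool :=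
  [forall x in K, forall y in K, (x != y) ==> e x y].

Definition clique_number : nat := \max_(K : {set T} | clique K) #|K|.

(* c lists the vertices in cyclic order: adjacency within c is exactly cyclic
   consecutiveness, so consecutive vertices are adjacent and c has no chord. *)
Definition induced_cycle (c : seq T) : Prop :=
  [/\ 2 < size c, uniq c &
      {in c &, forall x y, e x y = (y == next c x) || (x == next c y)}].

Definition chordal : Prop :=
  ~ exists c : seq T, 4 <= size c /\ induced_cycle c.

End Graphs.

(* Algorithms are structured programs for a random access machine with
   registers and an indirectly addressed memory, both indexed by nat and
   holding natural numbers.  The only arithmetic is addition and truncated
   subtraction, so t steps lengthen the numbers by O(t) bits: unit-cost time is
   polynomially related to Turing machine time. *)
Inductive program : Type :=
| Skip
| Const of nat & nat  (* r_i := k *)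
| Plus of nat & nat & nat  (* r_i := r_j + r_k *)
| Minus of nat & nat & nat  (* r_i := r_j - r_k, truncated at 0 *)
| Read of nat & nat  (* r_i := memory[r_j] *)
| Write of nat & nat  (* memory[r_i] := r_j *)
| Seq of program & program
| If of nat & program & program  (* tests r_i <> 0 *)
| While of nat & program.  (* loops as long as r_i <> 0 *)

Record state : Type := State { reg : nat -> nat; memory : nat -> nat }.

Definition update (f : nat -> nat) (i v : nat) : nat -> nat :=
  fun j => if j == i then v else f j.

Definition set_reg (s : state) (i v : nat) : state :=
  State (update (reg s) i v) (memory s).

Definition set_mem (s : state) (a v : nat) : state :=
  State (reg s) (update (memory s) a v).

(* exec p s t s': p started in state s halts in state s' after exactly t time
   units, one for each elementary instruction and each test. *)
Inductive exec : program -> state -> nat -> state -> Prop :=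
| exec_skip s : exec Skip s 1 s
| exec_const i k s : exec (Const i k) s 1 (set_reg s i k)
| exec_plus i j k s :
    exec (Plus i j k) s 1 (set_reg s i (reg s j + reg s k))
| exec_minus i j k s :
    exec (Minus i j k) s 1 (set_reg s i (reg s j - reg s k))
| exec_read i j s : exec (Read i j) s 1 (set_reg s i (memory s (reg s j)))
| exec_write i j s : exec (Write i j) s 1 (set_mem s (reg s i) (reg s j))
| exec_seq p q s s1 s2 t1 t2 :
    exec p s t1 s1 -> exec q s1 t2 s2 -> exec (Seq p q) s (t1 + t2) s2
| exec_if_nonzero i p q s s1 t :
    reg s i <> 0 -> exec p s t s1 -> exec (If i p q) s t.+1 s1
| exec_if_zero i p q s s1 t :
    reg s i = 0 -> exec q s t s1 -> exec (If i p q) s t.+1 s1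
| exec_while_stop i p s : reg s i = 0 -> exec (While i p) s 1 s
| exec_while_step i p s s1 s2 t1 t2 :
    reg s i <> 0 -> exec p s t1 s1 -> exec (While i p) s1 t2 s2 ->
    exec (While i p) s (t1 + t2).+1 s2.

(* Register 0 holds the numerical input (all other registers being 0) and,
   on halting, the output. *)
Definition input_regs (n : nat) : nat -> nat := update (fun=> 0) 0 n.

Definition output (s : state) : nat := reg s 0.

Definition nat_input (n : nat) : state := State (input_regs n) (fun=> 0).

(* A graph with vertices 0, ..., n-1 is input as n together with its adjacency
   matrix, stored row by row from address 0. *)
Definition graph_input (n : nat) (e : rel 'I_n) : state :=
  State (input_regs n)
    (fun a => [exists i : 'I_n, exists j : 'I_n,
                 (a == i * n + j :> nat) && e i j] : nat).

Definition computable (f : nat -> nat) : Prop :=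
  exists p : program, forall k : nat,
    exists (t : nat) (s : state), exec p (nat_input k) t s /\ output s = f k.

(* Main.v *)
(* An edge open packing is the edge set of an induced star forest, so the task is
   to label vertices as centres or as leaves of a given centre, under constraints
   on single edges of the graph, with as many leaves as possible.  A clique meets
   a star forest in at most two vertices, so a labelling has only quadratically
   many traces on a clique.  A chordal graph can be dismantled by repeatedly
   deleting a simplicial vertex, and dynamic programming along this elimination,
   with one table per vertex indexed by the traces on its later neighbours, takes
   polynomial time whatever the clique number: f = 1 suffices. *)
Require Import Defs.
From mathcomp Require Import all_boot all_algebra zify.

Set Implicit Arguments.
Unset Strict Implicit.
Unset Printing Implicit Defensive.

(** * Star labellings *)

(** A leaf carries the name of its centre because this makes every condition local: the label of the
    centre is forced by the edge between the two, even if that edge lies outside the clique at hand.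
    The table of a vertex depends only on tables of vertices of smaller rank, so all tables are
    recomputed [n] times from zero instead of being visited in order of rank; the wasted rounds cost
    a polynomial factor and spare the program any sorting. The machine has neither multiplication
    nor procedures. The algorithm is therefore written in a small language whose loops all run
    exactly [n] times, so that a polynomial time bound is read off from the syntax, whatever the
    memory holds. *)

Section StarLabellings.
Variables (V : finType) (e : rel V).
Hypotheses (e_sym : symmetric e) (e_irr : irreflexive e).

(* f x = Some x makes x a centre, f x = Some a with a != x a leaf of a, and
   f x = None leaves x out. *)
Definition compat (x : V) (lx : option V) (y : V) (ly : option V) : bool :=
  match lx, ly with
  | None, None => true
  | None, Some b => b != x
  | Some a, None => a != y
  | Some a, Some b => (a == x) && (b == x) || (a == y) && (b == y)
  end.

Lemma compatC x lx y ly : compat x lx y ly = compat y ly x lx.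
Proof. by case: lx ly => [a|] [b|] //=; rewrite orbC andbC [(b == x) && _]andbC. Qed.

Definition is_leaf (x : V) (lx : option V) : bool :=
  if lx is Some a then a != x else false.

Definition adjacent_labels (f : V -> option V) : Prop :=
  forall x a, f x = Some a -> a = x \/ e x a.

(** [adjacent_labels] only asks that a leaf names a neighbour; that this neighbour is a centre
    follows from [compat] on the edge joining them. *)
Definition star_labelling (f : V -> option V) : Prop :=
  adjacent_labels f /\ forall x y, e x y -> compat x (f x) y (f y).

Definition leaves (f : V -> option V) : {set V} := [set x | is_leaf x (f x)].

Lemma edgesP a :
  reflect (exists x y, e x y /\ a = [set x; y]) (a \in edges e).
Proof.
rewrite inE; apply: (iffP existsP) => [[x /existsP[y /andP[? /eqP->]]]|].
  by exists x, y.
by case=> x [y [exy ->]]; exists x; apply/existsP; exists y; rewrite exy eqxx.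
Qed.

Lemma edges_set2 x y : ([set x; y] \in edges e) = e x y.
Proof.
apply/edgesP/idP => [[x' [y' [e' /setP E]]]|exy]; last by exists x, y.
have nxy' : x' != y' by apply: contraTneq e' => ->; rewrite e_irr.
have := E x'; have := E y'; have := E x; have := E y.
rewrite !inE !eqxx ?orbT /= => /esym h1 /esym h2 h3 h4.
case/orP: h4 => /eqP E1; case/orP: h3 => /eqP E2.
- by rewrite E1 E2 eqxx in nxy'.
- by rewrite -E1 -E2.
- by rewrite -E1 -E2 e_sym.
- by rewrite E1 E2 eqxx in nxy'.
Qed.

Lemma conflictP (a b : {set V}) :
  reflect (exists x y, [/\ x \in a, y \in b, e x y, [set x; y] != a & [set x; y] != b])
          (conflict e a b).
Proof.
apply: (iffP existsP) => [[c /andP[]]|[x [y [xa yb exy na nb]]]].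
  rewrite !inE negb_or => /andP[/andP[na nb] ce].
  case/existsP=> x /andP[xa /existsP[y /andP[yb /eqP E]]].
  exists x, y; rewrite -E; split=> //; rewrite -edges_set2 -E.
  by rewrite inE.
exists [set x; y]; rewrite !inE (negPf na) (negPf nb) /=.
have := exy; rewrite -edges_set2 inE => -> /=.
by apply/existsP; exists x; rewrite xa; apply/existsP; exists y; rewrite yb eqxx.
Qed.

Lemma eopP (D : {set {set V}}) :
  reflect (D \subset edges e /\
           forall a b, a \in D -> b \in D -> a != b -> ~~ conflict e a b)
          (edge_open_packing e D).
Proof.
apply: (iffP andP) => -[DE H]; split=> //.
  by move=> a b aD bD; move/forall_inP: H => /(_ a aD)/forall_inP/(_ b bD)/implyP.
by apply/forall_inP=> a aD; apply/forall_inP=> b bD; apply/implyP; apply: H.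
Qed.

(** A leaf is sent to the edge to its centre, injectively because a centre is never a leaf. An edge
    joining two of these edges has both ends labelled, so [compat] makes it a star edge, hence one
    of the two. *)
Lemma leaves_le_eop f : star_labelling f -> #|leaves f| <= eop_number e.
Proof.
move=> [fadj fok].
pose g x := [set x; odflt x (f x)].
have leafP x : x \in leaves f ->
    exists a, [/\ f x = Some a, a != x, e x a, f a = Some a & g x = [set x; a]].
  rewrite inE /g; case fx: (f x) => [a|] //= nax; exists a.
  have [|exa] := fadj _ _ fx; first by move=> E; rewrite E eqxx in nax.
  split=> //; have := fok _ _ exa; rewrite fx /=.
  case: (f a) => [b|]; last by rewrite eqxx.
  by rewrite (negPf nax) eqxx /= => /eqP->.
have ginj : {in leaves f &, injective g}.
  move=> x y /leafP[a [fx nax _ fa ->]] /leafP[b [fy nby _ fb ->]] /setP E.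
  have := E x; rewrite !inE eqxx /= => /esym/orP[/eqP//|/eqP xb].
  by move: fx nax; rewrite xb fb => -[->]; rewrite eqxx.
rewrite -(card_in_imset ginj); apply: leq_bigmax_cond.
apply/eopP; split.
  apply/subsetP=> _ /imsetP[x /leafP[a [_ _ exa _ ->]] ->].
  by rewrite edges_set2.
move=> _ _ /imsetP[x xL ->] /imsetP[y yL ->] nxy; apply/conflictP.
have [a [fx nax _ fa gx]] := leafP _ xL; have [b [fy nby _ fb gy]] := leafP _ yL.
rewrite gx gy => -[z [w [za wb ezw nza nwb]]].
have fz : f z = Some a by move: za; rewrite !inE => /orP[]/eqP->.
have fw : f w = Some b by move: wb; rewrite !inE => /orP[]/eqP->.
have nzw : z != w by apply: contraTneq ezw => ->; rewrite e_irr.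
have := fok _ _ ezw; rewrite fz fw /= => /orP[]/andP[/eqP Ea /eqP Eb].
  subst a b; move: wb; rewrite !inE [w == z]eq_sym (negPf nzw) orbF => /eqP Ew.
  by rewrite Ew setUC eqxx in nwb.
subst a b; move: za; rewrite !inE (negPf nzw) orbF => /eqP Ez.
by rewrite Ez eqxx in nza.
Qed.

(* In a D-edge only one end can have further D-edges; it is the centre of its
   star, and ties (isolated D-edges) are broken by enum_rank. *)
Lemma eop_labelling D : edge_open_packing e D ->
  exists2 f, star_labelling f & #|D| <= #|leaves f|.
Proof.
case/eopP=> /subsetP DE Dc.
pose d x y := [set x; y] \in D.
have dC x y : d x y = d y x by rewrite /d setUC.
have de x y : d x y -> e x y by move/DE; rewrite edges_set2.
have dn x y : d x y -> x != y.
  by move/de; apply: contraTneq => ->; rewrite e_irr.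
pose N x := [set y | d x y].
(* Lexicographic order by degree in [D], then by [enum_rank], packed into one number since
   [enum_rank] is below [#|V|]. *)
pose key x := #|N x| * #|V| + enum_rank x.
have keyI x y : key x = key y -> x = y.
  rewrite /key => E; apply/enum_rank_inj/val_inj.
  have V0 : 0 < #|V| by apply/card_gt0P; exists x.
  have := congr1 (modn^~ #|V|) E.
  by rewrite !modnMDl !modn_small // ltn_ord.
have keyN x y : key x < key y -> #|N x| <= #|N y|.
  rewrite /key => lt; rewrite leqNgt; apply/negP => lN.
  suff : #|N y| * #|V| + enum_rank y < #|N x| * #|V| + enum_rank x.
    by rewrite ltnNge (ltnW lt).
  apply: (@leq_trans (#|N y|.+1 * #|V|)); first by rewrite mulSnr ltn_add2l.
  by apply: leq_trans (leq_addr _ _); rewrite leq_mul2r lN orbT.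
(* If [x] had another D-neighbour [y'], then [y], whose degree is no smaller, would have a
   D-neighbour [z] other than [x], and the edge [xy] would make [xy'] and [yz] conflict. *)
have uniqN x y y' : d x y -> key x < key y -> d x y' -> y' = y.
  move=> dxy lt dxy'; apply/eqP/negPn/negP => nyy'.
  have c2 : 1 < #|N y|.
    apply: leq_trans (keyN _ _ lt).
    apply/card_gt1P; exists y, y'; rewrite !inE; split=> //.
    by rewrite eq_sym.
  have /card_gt0P[z] : 0 < #|N y :\ x|.
    by have := cardsD1 x (N y); rewrite inE dC dxy /= ; lia.
  rewrite !inE => /andP[nzx dyz].
  have nxy := dn _ _ dxy.
  have D1 : x \notin [set y; z] by rewrite !inE negb_or nxy eq_sym nzx.
  have D2 : y \notin [set x; y'] by rewrite !inE negb_or eq_sym nxy eq_sym nyy'.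
  have ne : [set x; y'] != [set y; z].
    by apply: contraNneq D1 => <-; rewrite !inE eqxx.
  have /negP := Dc _ _ dxy' dyz ne; apply; apply/conflictP.
  exists x, y; split; rewrite ?inE ?eqxx //; first exact: de.
    by apply: contraNneq D2 => <-; rewrite !inE eqxx orbT.
  by apply: contraNneq D1 => <-; rewrite !inE eqxx.
pose f x := if [pick y | d x y && (key x < key y)] is Some y then Some y
            else if [exists y, d x y] then Some x else None.
have fleaf x y : d x y -> key x < key y -> f x = Some y.
  move=> dxy lt; rewrite /f; case: pickP => [z /andP[dxz _]|/(_ y)].
    by rewrite (uniqN _ _ _ dxy lt dxz).
  by rewrite dxy lt.
have fcen x y : d x y -> key x < key y -> f y = Some y.
  move=> dxy lt; rewrite /f; case: pickP => [z /andP[dyz lt']|_].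
    have : x = z by apply: (uniqN y z) => //; rewrite dC.
    by move=> E; move: lt'; rewrite -E ltnNge (ltnW lt).
  by have -> : [exists z, d y z] by apply/existsP; exists x; rewrite dC.
have key_d x y : d x y -> (key x < key y) || (key y < key x).
  move=> dxy; case: ltngtP => // /keyI E.
  by have := dn _ _ dxy; rewrite E eqxx.
have fS x a : f x = Some a -> exists y, d x y.
  rewrite /f; case: pickP => [y /andP[dxy _] _|_]; first by exists y.
  by case: existsP => // -[y dxy] _; exists y.
have fadj x a : f x = Some a -> a = x \/ d x a.
  rewrite /f; case: pickP => [y /andP[dxy _] [<-]|_]; first by right.
  by case: ifP => // _ [->]; left.
have dfS x y : d x y -> f x <> None.
  by move=> dxy; case/orP: (key_d _ _ dxy) => lt;
    [rewrite (fleaf _ _ dxy lt)|rewrite dC in dxy; rewrite (fcen _ _ dxy lt)].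
exists f; first split.
- by move=> x a /fadj[->|/de]; [left|right].
- move=> x y exy; case fx: (f x) => [a|]; case fy: (f y) => [b|] //=.
  + have [x' dx] := fS _ _ fx; have [y' dy] := fS _ _ fy.
    (* Otherwise the edge [xy], not in [D], makes a D-edge at [x] conflict with one at [y]; if these
       coincide, they are [xy] itself. *)
    have dxy : d x y.
      apply/negPn/negP => ndxy.
      have nx : [set x; y] != [set x; x'] by apply: contraNneq ndxy; rewrite /d => ->.
      have ny : [set x; y] != [set y; y'] by apply: contraNneq ndxy; rewrite /d => ->.
      have [E|ne] := eqVneq [set x; x'] [set y; y'].
        have : y \in [set x; x'] by rewrite E !inE eqxx.
        have nyx : y != x by apply: contraTneq exy => ->; rewrite e_irr.
        rewrite !inE (negPf nyx) /= => /eqP Ey.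
        by rewrite Ey eqxx in nx.
      have /negP := Dc _ _ dx dy ne; apply; apply/conflictP.
      by exists x, y; rewrite !inE !eqxx.
    case/orP: (key_d _ _ dxy) => lt.
      move: fx fy; rewrite (fleaf _ _ dxy lt) (fcen _ _ dxy lt) => -[<-] [<-].
      by rewrite eqxx orbT.
    rewrite dC in dxy.
    move: fx fy; rewrite (fleaf _ _ dxy lt) (fcen _ _ dxy lt) => -[<-] [<-].
    by rewrite eqxx.
  + apply/eqP=> E; case: (fadj _ _ fx) => E'; first by rewrite -E E' fx in fy.
    by move: E'; rewrite dC E => /dfS.
  + apply/eqP=> E; case: (fadj _ _ fy) => E'; first by rewrite -E E' fy in fx.
    by move: E'; rewrite dC E => /dfS.
(* Each edge of [D] is recovered from its end of smaller key, which is a leaf. *)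
- pose g x := [set x; odflt x (f x)].
  apply: leq_trans (leq_imset_card g (leaves f)).
  apply/subset_leq_card/subsetP => c cD.
  have [x [y [_ E]]] := edgesP _ (DE _ cD).
  have dxy : d x y by rewrite /d -E.
  wlog lt : x y E dxy / key x < key y => [wl|].
    case/orP: (key_d _ _ dxy) => lt; first exact: wl dxy lt.
    by apply: wl lt; rewrite ?(dC y) // setUC.
  apply/imsetP; exists x; last by rewrite /g (fleaf _ _ dxy lt).
  by rewrite inE (fleaf _ _ dxy lt) /= eq_sym dn.
Qed.

Lemma eop_numberE k :
  (forall f, star_labelling f -> #|leaves f| <= k) ->
  (exists2 f, star_labelling f & #|leaves f| = k) -> k = eop_number e.
Proof.
move=> ub [f fV fk]; apply/eqP; rewrite eqn_leq -{1}fk leaves_le_eop //=.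
apply/bigmax_leqP => D /eop_labelling[f' f'V le]; exact: leq_trans le (ub _ f'V).
Qed.

End StarLabellings.

(** * Simplicial vertices of chordal graphs *)

Section Simplicial.
Variables (V : finType) (e : rel V).
Hypotheses (e_sym : symmetric e) (e_irr : irreflexive e).

Lemma shortest_path (r : rel V) (x y : V) : connect r x y ->
  exists p, [/\ path r x p, last x p = y &
    forall q, path r x q -> last x q = y -> size p <= size q].
Proof.
case/connectP=> p0 rp0 Ep0.
pose P k := [exists p : k.-tuple V, path r x p && (last x p == y)].
have exP : exists k, P k.
  by exists (size p0); apply/existsP; exists (in_tuple p0); rewrite rp0 -Ep0 eqxx.
case: (ex_minnP exP) => k /existsP[p /andP[rp /eqP Ep]] min.
exists p; split=> // q rq Eq; rewrite size_tuple; apply: min.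
by apply/existsP; exists (in_tuple q); rewrite rq Eq eqxx.
Qed.

(** A step from position [i] beyond position [i.+1] would give a shorter path, joining the part up
    to [i] directly to the part from [j] on. Position 0 is [x], so positions in [p] are lower by
    one. *)
Lemma shortest_path_chordless (r : rel V) (x : V) p i j :
    path r x p ->
    (forall q, path r x q -> last x q = last x p -> size p <= size q) ->
  i < j -> j <= size p -> r (nth x (x :: p) i) (nth x (x :: p) j) -> j = i.+1.
Proof.
move=> rp min ij jp rij; apply/eqP; rewrite eqn_leq ij andbT leqNgt.
apply/negP=> lt; case: j => // j in ij jp rij lt.
pose q := take i p ++ drop j p.
have Edrop : drop j p = nth x p j :: drop j.+1 p by rewrite (drop_nth x).
have Elast : last x (take i p) = nth x (x :: p) i.
  by rewrite (last_nth x) size_takel; [case: (i) lt => //= k lt; rewrite nth_take|lia].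
have := min q; rewrite /q size_cat size_take size_drop ifT; last by lia.
have rest : path r (nth x p j) (drop j.+1 p).
  have := rp; rewrite -{1}(cat_take_drop j p) cat_path Edrop /=.
  by case/and3P.
rewrite cat_path last_cat Edrop /= Elast.
rewrite take_path //= rest /= in rij *; rewrite rij.
have -> : last (nth x p j) (drop j.+1 p) = last x p.
  by rewrite -[in RHS](cat_take_drop j p) last_cat Edrop.
move/(_ isT erefl); lia.
Qed.

Lemma induced_cycle_of_path (r y : V) (p : seq V) :
    uniq (r :: y :: p) -> 1 < size p ->
    (forall i j, i < j -> j <= size p ->
       e (nth y (y :: p) i) (nth y (y :: p) j) = (j == i.+1)) ->
    (forall i, i <= size p ->
       e r (nth y (y :: p) i) = (i == 0) || (i == size p)) ->
  induced_cycle e [:: r, y & p].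
Proof.
move=> Uc p1 Hs Hr; split=> //; first by rewrite /= !ltnS; exact: ltnW.
set c := [:: r, y & p].
have sc : size c = (size p).+2 by [].
move=> a b /(nthP r)[i ic <-] /(nthP r)[j jc <-].
have nxt k : k < size c -> next c (nth r c k) = nth r (y :: p) k.
  move=> kc; rewrite next_nth mem_nth // index_uniq //.
have Ec k l : k < size c -> l < size c -> (nth r c k == nth r c l) = (k == l).
  by move=> kc lc; rewrite nth_uniq.
(* Everything reduces to indices: the successor of position [k] is [k.+1], wrapping to 0 at the last
   position [(size p).+1]. *)
have nx k l : k < size c -> l < size c ->
    (nth r c l == next c (nth r c k)) = (l == (if k < (size p).+1 then k.+1 else 0)).
  move=> kc lc; rewrite nxt // -[nth r (y :: p) k]/(nth r c k.+1).
  case: ifP => kp; first by rewrite Ec.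
  rewrite -(Ec l 0) //; congr (_ == _).
  by rewrite nth_default //; move: kp; rewrite /c /= ; lia.
rewrite !nx //.
have nc k : k <= size p -> nth r c k.+1 = nth y (y :: p) k.
  by move=> kp; rewrite /c /= ; apply: set_nth_default.
have main k l : k < l -> l < size c ->
    e (nth r c k) (nth r c l) =
    (l == (if k < (size p).+1 then k.+1 else 0)) ||
    (k == (if l < (size p).+1 then l.+1 else 0)).
  case: k => [|k]; case: l => [|l] // kl; rewrite sc => lc.
    rewrite nc; last by lia.
    rewrite [nth r c 0]/= Hr; last by lia.
    by rewrite ltn0Sn; case: ifP => *; lia.
  rewrite !nc; try lia; rewrite Hs; try lia.
  by repeat (case: ifP => ?); lia.
case: (ltngtP i j) => [ij|ji|->].
- exact: main.
- by rewrite e_sym main // orbC.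
- by rewrite e_irr; rewrite sc in jc; case: ifP; lia.
Qed.

Definition within (A : {set V}) : rel V :=
  fun x y => [&& x \in A, y \in A & e x y].

Lemma within_sym (A : {set V}) : symmetric (within A).
Proof. by move=> x y; rewrite /within e_sym andbCA. Qed.

Lemma path_within (A : {set V}) x p :
  x \in A -> path (within A) x p -> {subset x :: p <= A}.
Proof.
elim: p x => [|y p IH] x xA /=; first by move=> _ z /[!inE] /eqP->.
case/andP=> /and3P[_ yA _] yp z; rewrite in_cons => /orP[/eqP->//|].
exact: IH yp z.
Qed.

Definition connected (A : {set V}) : bool :=
  [forall x in A, forall y in A, connect (within A) x y].

Lemma connectedP (A : {set V}) :
  reflect {in A &, forall x y, connect (within A) x y} (connected A).
Proof.
apply: (iffP forall_inP) => [H x y xA yA|H x xA].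
  by have /forall_inP := H x xA; apply.
by apply/forall_inP => y yA; apply: H.
Qed.

Lemma within_mono (A B : {set V}) x y :
  A \subset B -> connect (within A) x y -> connect (within B) x y.
Proof.
move=> /subsetP AB; apply: connect_sub => a b /and3P[aA bA eab].
by apply: connect1; rewrite /within !AB.
Qed.

Lemma connected_setU1 (A : {set V}) x y :
  connected A -> x \in A -> e x y -> connected (y |: A).
Proof.
move=> /connectedP cA xA exy.
have toy z : z \in y |: A -> connect (within (y |: A)) z y.
  rewrite in_setU1 => /orP[/eqP->|zA]; first exact: connect0.
  apply: connect_trans (within_mono (subsetUr _ _) (cA _ _ zA xA)) (connect1 _).
  by rewrite /within !inE eqxx xA orbT.
apply/connectedP=> a b /toy ay /toy.
rewrite (sym_connect_sym (@within_sym _)); exact: connect_trans.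
Qed.

(* Take X connected and maximal among those not dominating A.  The vertices R of
   A that X does not dominate are adjacent to all of N(X) by maximality, and N(X)
   is a clique, since a chordless path through X between two non-adjacent members
   would close up to an induced cycle at a vertex of R.  So a simplicial vertex
   of R is simplicial in A. *)
Lemma simplicial_vertex (A : {set V}) : chordal e -> A != set0 ->
  exists2 v, v \in A & {in A &, forall x y, e v x -> e v y -> x != y -> e x y}.
Proof.
move=> chord; have [k] := ubnP #|A|; elim: k A => // k IH A leA A0.
have [/forall_inP cA|] := boolP [forall x in A, forall y in A, (x != y) ==> e x y].
  have /set0Pn[v vA] := A0; exists v => // x y xA yA _ _.
  by have /forall_inP/(_ y yA)/implyP := cA x xA.
case/forall_inPn=> v vA /forall_inPn[w wA]; rewrite negb_imply => /andP[nvw nevw].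
pose far (X : {set V}) r := (r \notin X) && [forall x in X, ~~ e x r].
pose P (X : {set V}) :=
  [&& X != set0, X \subset A, connected X & [exists r in A, far X r]].
(* Maximality needs one candidate: [v] alone misses its non-neighbour [w]. *)
have Pv : P [set v].
  apply/and4P; split; rewrite ?sub1set //; first by apply/set0Pn; exists v; rewrite set11.
    by apply/connectedP=> a b /set1P-> /set1P->; exact: connect0.
  apply/exists_inP; exists w; rewrite // /far in_set1 eq_sym nvw /=.
  by apply/forall_inP=> x /set1P->.
have [X /maxsetP[/and4P[X0 XA cX /exists_inP[r rA rfar]] Xmax] _] := maxset_exists Pv.
pose R := [set r in A | far X r].
pose N := [set y in A | (y \notin X) && ~~ [forall x in X, ~~ e x y]].
have NP y : y \in N -> [/\ y \in A, y \notin X & exists2 x, x \in X & e x y].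
  rewrite inE => /and3P[-> -> /forall_inPn[x xX]]; rewrite negbK; split=> //.
  by exists x.
have RP y z : z \in R -> y \in X -> e y z = false.
  by rewrite inE => /and3P[_ _ /forall_inP H] /H/negPf.
have NR y z : y \in N -> z \in R -> e y z.
  move=> /NP[yA yX [x xX exy]] zR; apply/negPn/negP => neyz.
  have := zR; rewrite inE => /and3P[zA zX _].
  have : P (y |: X).
    apply/and4P; split; first by apply/set0Pn; exists y; rewrite setU11.
    - by apply/subsetP=> a /setU1P[->|/(subsetP XA)].
    - exact: connected_setU1 exy.
    - apply/exists_inP; exists z => //; rewrite /far in_setU1 negb_or zX andbT.
      apply/andP; split; first by apply: contraTneq exy => <-; rewrite (RP x z).
      by apply/forall_inP=> a /setU1P[->//|aX]; rewrite RP.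
  by move/Xmax/(_ (subsetUr _ _))=> E; rewrite -E setU11 in yX.
have rR : r \in R by rewrite inE rA.
have Ncl : {in N &, forall y z, y != z -> e y z}.
  move=> y z yN zN nyz; apply/negPn/negP => neyz; apply: chord.
  have [yA yX [x xX exy]] := NP _ yN; have [zA zX [x' x'X exz]] := NP _ zN.
  (* A shortest path through [Y] has its interior in [X], where [r] has no neighbour, so [r] sees
     only its ends [y] and [z]. *)
  pose Y := z |: (y |: X).
  have cY : connected Y.
    by apply: connected_setU1 exz; [exact: connected_setU1 exy|rewrite in_setU1 x'X orbT].
  have /connectedP/(_ y z) := cY; rewrite /Y !inE !eqxx ?orbT => /(_ isT isT).
  case/shortest_path=> p [pp pz pmin].
  (* Removing repetitions cannot go below the minimal length, so there are none. *)
  have Us : uniq (y :: p).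
    have := pz; case/shortenP: (pp) => p' p'p Up' sub pz'.
    apply: (leq_size_uniq Up'); last exact: pmin.
    by move=> a; rewrite !in_cons => /orP[->//|/sub->]; rewrite orbT.
  have yY : y \in Y by rewrite !inE eqxx orbT.
  have pY := path_within yY pp.
  have nY i : i <= size p -> nth y (y :: p) i \in Y by move=> ip; apply/pY/mem_nth.
  have nz : nth y (y :: p) (size p) = z by rewrite -last_nth.
  have rX : r \notin X by have := rfar; rewrite /far => /andP[].
  have rY : r \notin Y.
    rewrite !inE !negb_or rX andbT; apply/andP.
    by split; [have := NR _ _ zN rR|have := NR _ _ yN rR]; apply: contraTneq => ->;
       rewrite e_irr.
  have p1 : 1 < size p.
    case: (p) pp pz => [|b [|//]] /= pp Eb; first by rewrite Eb eqxx in nyz.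
    by move: pp; rewrite /within Eb (negPf neyz) !andbF.
  exists [:: r, y & p]; split; first by rewrite /= !ltnS.
  apply: induced_cycle_of_path => //.
  - rewrite cons_uniq Us andbT; apply: contra rY; exact: pY.
  - move=> i j ij jp; apply/idP/eqP => [eij|Ej].
      apply: (shortest_path_chordless pp) => //; first by rewrite pz.
      by rewrite /within eij !nY //; apply: leq_trans jp; apply: ltnW.
    by subst j; have /(pathP y)/(_ i jp)/and3P[] := pp.
  - move=> i ip; have [->|i0] /= := eqVneq i 0; first by rewrite e_sym NR.
    have [->|ip'] /= := eqVneq i (size p); first by rewrite nz e_sym NR.
    have iX : nth y (y :: p) i \in X.
      have := nY _ ip; rewrite !inE -{1}nz nth_uniq //= (negPf ip') /=.
      by rewrite -[X in _ == X]/(nth y (y :: p) 0) nth_uniq // (negPf i0).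
    by rewrite e_sym RP.
have RA : R \subset A by apply/subsetP => z; rewrite inE => /andP[].
have Rk : #|R| < k.
  rewrite -ltnS; apply: leq_trans leA; rewrite ltnS; apply: proper_card.
  have /set0Pn[x xX] := X0; apply/properP; split=> //.
  by exists x; [exact: (subsetP XA)|rewrite inE /far xX andbF].
have [|u uR simp] := IH R Rk; first by apply/set0Pn; exists r.
(* A neighbour of [u] in [A] lies outside [X], as [u] is in [R]; so [X] either misses it or has it
   in [N]. *)
have split_nbr x : x \in A -> e u x -> (x \in R) || (x \in N).
  move=> xA eux; rewrite !inE /far xA /=.
  have -> : x \notin X by apply: contraTN eux => xX; rewrite e_sym RP.
  by rewrite orbN.
exists u; first exact: (subsetP RA).
move=> x y xA yA eux euy nxy.
case/orP: (split_nbr x xA eux) => xR; case/orP: (split_nbr y yA euy) => yR.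
- exact: simp.
- by rewrite e_sym NR.
- exact: NR.
- exact: Ncl.
Qed.

End Simplicial.

(** * Dynamic programming along an elimination order *)

Section Elimination.
Variables (V : finType) (e : rel V) (r : V -> nat).

Definition up (v w : V) : bool := e v w && (r v < r w).

(* u is the vertex of least rank in up v. *)
Definition child (u v : V) : bool :=
  up v u && ~~ [exists w, up v w && (r w < r u)].

(* A pair (x, a) encodes the labelling of a clique in which x has label a, so has
   a if it lies in the clique, and nothing else is labelled.  On up v the pair
   (v, v) encodes the empty labelling, as v is not in up v. *)
Definition restrict (v x a : V) : V * V :=
  if up v x then (x, a) else if up v a then (a, a) else (v, v).

(** The pair [(x, a)] labels the bag formed by [u] and its later neighbours, with trace [(p, q)] on
    the latter. The centre [a] of a leaf [x] may lie outside the bag. *)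
Definition extends (u p q x a : V) : bool :=
  [&& (x == u) || up u x, (a == x) || e x a & restrict u x a == (p, q)].

(** A leaf is counted when it is eliminated, so only [u] contributes directly; the rest comes from
    the children, whose tables see only the trace of [(x, a)]. *)
Definition gain (M : V -> V -> V -> nat) (u x a : V) : nat :=
  (x == u) && (a != x) +
  \sum_(v | child u v) M v (restrict v x a).1 (restrict v x a).2.

Definition gain0 (M : V -> V -> V -> nat) (u : V) : nat :=
  \sum_(v | child u v) M v v v.

(** No pair [(x, a)] with [x] in the bag codes the empty labelling of the bag, whence the separate
    first term. *)
Definition table_step (M : V -> V -> V -> nat) (u p q : V) : nat :=
  maxn (if (p == u) && (q == u) then gain0 M u else 0)
       (\max_x \max_a if extends u p q x a then gain M u x a else 0).

Fixpoint table (k : nat) : V -> V -> V -> nat :=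
  if k is k'.+1 then table_step (table k') else fun _ _ _ => 0.

Lemma child_lt u v : child u v -> r v < r u.
Proof. by case/andP=> /andP[]. Qed.

Lemma table_step_ext M M' u :
  (forall v, child u v -> M v =2 M' v) -> table_step M u =2 table_step M' u.
Proof.
move=> E p q; rewrite /table_step; congr maxn.
  by case: ifP => // _; apply: eq_bigr => v /E.
apply: eq_bigr => x _; apply: eq_bigr => a _; case: ifP => // _.
by congr (_ + _); apply: eq_bigr => v /E.
Qed.

Hypothesis r_gt0 : forall v, 0 < r v.

(** The table of [v] draws only on its children, which have smaller rank, so it is final after [r v]
    rounds. *)
Lemma table_stable k k' v :
  r v <= k -> r v <= k' -> table k v =2 table k' v.
Proof.
have [j] := ubnP (r v); elim: j v k k' => // j IH v k k' rj rk rk'.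
have r0 := r_gt0 v; case: k rk => [|k] rk; first by lia.
case: k' rk' => [|k'] rk'; first by lia.
apply: (@table_step_ext (table k) (table k')) => w /child_lt rw.
by apply: IH; lia.
Qed.

Lemma table_fixpoint n u : (forall v, r v <= n) ->
  table n u =2 table_step (table n) u.
Proof. by move=> rn; apply: (@table_stable n n.+1 u (rn u) (leqW (rn u))). Qed.

Hypotheses (e_sym : symmetric e) (e_irr : irreflexive e) (r_inj : injective r).
Hypothesis r_peo : forall v x y, up v x -> up v y -> x != y -> e x y.

(** * Codes for the traces of a labelling on later neighbours *)

Definition label (x a y : V) : option V :=
  if (y == x) || (y == a) then Some a else None.

(** Asking the first component to lie in [up v], unless the pair is the empty code [(v, v)], makes
    the code of a trace unique, so that it can serve as a table index. *)
Definition represents (f : V -> option V) (v : V) (pq : V * V) : bool :=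
  (up v pq.1 || (pq == (v, v))) &&
  [forall y, up v y ==> (f y == label pq.1 pq.2 y)].

Definition rep (f : V -> option V) (v : V) : V * V :=
  odflt (v, v) [pick pq | represents f v pq].

Lemma up_irr v : up v v = false.
Proof. by rewrite /up e_irr. Qed.

Lemma representsP f v pq :
  reflect ((up v pq.1 \/ pq = (v, v)) /\ forall y, up v y -> f y = label pq.1 pq.2 y)
          (represents f v pq).
Proof.
apply: (iffP andP) => -[H1 H2]; split.
- by case/orP: H1 => [|/eqP]; [left|right].
- by move=> y vy; apply/eqP; have /forallP/(_ y) := H2; rewrite vy.
- by case: H1 => [->//|->]; rewrite eqxx orbT.
- by apply/forallP=> y; apply/implyP=> vy; rewrite H2.
Qed.

Lemma represents_uniq f v pq pq' :
  represents f v pq -> represents f v pq' -> pq = pq'.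
Proof.
case: pq pq' => [p q] [p' q'] /representsP[/= H1 H2] /representsP[/= H1' H2'].
case: H1 => [vp|[Ep Eq]]; case: H1' => [vp'|[Ep' Eq']]; subst.
- have := H2 p vp; have := H2' p vp; have := H2 p' vp'; have := H2' p' vp'.
  rewrite /label !eqxx /= => E1 E2 E3 E4; move: E2 E3; rewrite E1 E4.
  case: (eqVneq p' p) => [->|_] /=; first by move=> [->].
  by case: (eqVneq p' q) => //= -> [->]; case: eqVneq => [->|].
- have := H2 p vp; rewrite H2' // /label !eqxx /= orbb.
  by case: eqP => // E; rewrite E up_irr in vp.
- have := H2' p' vp'; rewrite H2 // /label !eqxx /= orbb.
  by case: eqP => // E; rewrite E up_irr in vp'.
- by [].
Qed.

Lemma represents_rep f v pq : represents f v pq -> rep f v = pq.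
Proof.
move=> H; rewrite /rep; case: pickP => [pq' H'|/(_ pq)]; last by rewrite H.
exact: represents_uniq H' H.
Qed.

Lemma rep_ext f f' v : (forall y, up v y -> f y = f' y) -> rep f v = rep f' v.
Proof.
move=> E; rewrite /rep; congr odflt; apply: eq_pick => pq.
congr (_ && _); apply: eq_forallb => y; case: (boolP (up v y)) => //= vy.
by rewrite E.
Qed.

Lemma rep_none f v : (forall y, up v y -> f y = None) -> rep f v = (v, v).
Proof.
move=> N; apply/represents_rep/representsP; split; first by right.
move=> y vy; rewrite N // /label orbb; case: eqP => // E.
by rewrite E up_irr in vy.
Qed.

Lemma restrict_label v x a y :
  up v y -> label (restrict v x a).1 (restrict v x a).2 y = label x a y.
Proof.
rewrite /restrict => vy; case: ifP => [//|nvx].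
have nx : (y == x) = false by apply: contraFF nvx => /eqP<-.
case: ifP => [va|nva]; rewrite /label /= nx orbb //.
have -> : (y == a) = false by apply: contraFF nva => /eqP<-.
by case: eqP => // E; rewrite E up_irr in vy.
Qed.

Lemma rep_restrict f v x a :
  (forall y, up v y -> f y = label x a y) -> rep f v = restrict v x a.
Proof.
move=> H; apply/represents_rep/representsP; split.
  by rewrite /restrict; case: ifP; [left|case: ifP; [left|right]].
by move=> y vy; rewrite H // restrict_label.
Qed.

(** A leaf in a clique settles all other labels: any other labelled member must be its centre.
    Without a leaf there is at most one centre, two adjacent centres being incompatible. *)
Lemma clique_state (P : pred V) f :
    {in P &, forall x y, x != y -> e x y} ->
    {in P &, forall x y, e x y -> compat x (f x) y (f y)} ->
  (forall y, P y -> f y = None) \/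
  exists x a, [/\ P x, f x = Some a & forall y, P y -> f y = label x a y].
Proof.
move=> cl ok; case: (pickP (fun x => P x && is_leaf x (f x))) => [x|noleaf].
  case/andP=> Px; case fx: (f x) => [a|] //= nax; right; exists x, a; split=> // y Py.
  rewrite /label; case: eqVneq => [->//|nyx] /=; rewrite eq_sym in nyx.
  have := ok _ _ Px Py (cl _ _ Px Py nyx); rewrite fx /= (negPf nax) /=.
  case: (f y) => [b /andP[/eqP-> /eqP->]|nay]; first by rewrite eqxx.
  by rewrite eq_sym (negPf nay).
case: (pickP (fun x => P x && (f x != None))) => [x /andP[Px]|none]; last first.
  by left=> y Py; have := none y; rewrite Py /=; case: (f y).
case fx: (f x) => [a|] // _; right; exists x, a; split=> // y Py.
have Ea : a = x.
  by have := noleaf x; rewrite Px fx /= => /negbFE/eqP.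
subst a; rewrite /label orbb; case: eqVneq => [->//|nyx]; rewrite eq_sym in nyx.
have := ok _ _ Px Py (cl _ _ Px Py nyx); have := noleaf y; rewrite Py fx /=.
case: (f y) => [b|] //= /negbFE/eqP->.
by rewrite eqxx /= [y == x]eq_sym (negPf nyx).
Qed.

Lemma bag_clique u : {in predU1 u (up u) &, forall x y, x != y -> e x y}.
Proof.
move=> x y; rewrite !inE => /orP[/eqP->|ux] /orP[/eqP->|uy] nxy.
- by rewrite eqxx in nxy.
- by case/andP: uy.
- by rewrite e_sym; case/andP: ux.
- exact: (r_peo ux uy nxy).
Qed.

(** The running intersection property: [up v] is a clique in which [u] has least rank, so its other
    members are later neighbours of [u]. Hence a labelling of the bag of [u] determines the index
    into the table of [v]. *)
Lemma child_bag u v w : child u v -> up v w -> (w == u) || up u w.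
Proof.
case/andP=> vu /existsPn/(_ w); case: eqVneq => //= nwu H vw.
rewrite vw /= -leqNgt in H; rewrite /up ltn_neqAle H andbT (inj_eq r_inj) eq_sym nwu.
by rewrite andbT; apply: r_peo vu vw _; rewrite eq_sym.
Qed.

(** Upper bound half of one recursion step: by [clique_state] the labels on the bag are empty or
    coded by a pair, and either way they are a candidate in the maximum. *)
Lemma table_step_ge M f u :
    (forall x a, (x == u) || up u x -> f x = Some a -> a = x \/ e x a) ->
    (forall x y, (x == u) || up u x -> (y == u) || up u y -> e x y ->
       compat x (f x) y (f y)) ->
  is_leaf u (f u) + \sum_(v | child u v) M v (rep f v).1 (rep f v).2
    <= table_step M u (rep f u).1 (rep f u).2.
Proof.
move=> adj ok; rewrite /table_step.
have [N|[x [a [bx fx H]]]] := clique_state (@bag_clique u) ok.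
  have N' v y : child u v -> up v y -> f y = None by move=> cv /(child_bag cv)/N.
  have -> : f u = None by apply: N; rewrite /= eqxx.
  rewrite (@rep_none f u) /= ?eqxx => [|y uy]; last by apply: N; rewrite /= uy orbT.
  apply: leq_trans (leq_maxl _ _).
  rewrite add0n; apply: eq_leq; apply: eq_bigr => v cv.
  by rewrite (@rep_none f v) // => y; apply: N'.
apply: leq_trans (leq_maxr _ _); apply: leq_trans (leq_bigmax x).
apply: leq_trans (leq_bigmax a).
have Eu : rep f u = restrict u x a.
  by apply: rep_restrict => y uy; apply: H; rewrite /= uy orbT.
have -> : extends u (rep f u).1 (rep f u).2 x a.
  apply/and3P; split=> //; last by rewrite Eu -surjective_pairing.
  by case: (adj x a bx fx) => ->; rewrite ?eqxx ?orbT.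
rewrite /gain; apply: leq_add.
  have -> : f u = label x a u by apply: H; rewrite /= eqxx.
  rewrite /label; case: eqVneq => [->|_] /=; first by [].
  by case: eqVneq => [->|_] /=; rewrite ?eqxx.
apply: eq_leq; apply: eq_bigr => v cv; rewrite (@rep_restrict f v x a) //.
by move=> y /(child_bag cv); apply: H.
Qed.

(** Converse half: the best candidate prescribes a label [l] for [u]. Only [u] is relabelled, since
    the candidate has the trace of [g] on [up u]. *)
Lemma table_step_attained M g u p q :
    represents g u (p, q) ->
    (forall x a, up u x -> g x = Some a -> a = x \/ e x a) ->
  exists l, let f := fun y => if y == u then l else g y in
    [/\ forall a, l = Some a -> a = u \/ e u a,
        forall y, up u y -> compat u l y (g y) &
        table_step M u p q =
          is_leaf u l + \sum_(v | child u v) M v (rep f v).1 (rep f v).2].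
Proof.
move=> /representsP[/= H1 H2] adj.
have Pnone : (p, q) = (u, u) ->
    let f := fun y => if y == u then None else g y in
    [/\ forall a : V, None = Some a -> a = u \/ e u a,
        forall y, up u y -> compat u None y (g y) &
        gain0 M u = is_leaf u None + \sum_(v | child u v) M v (rep f v).1 (rep f v).2].
  case=> Ep Eq f; subst p q; have N y : up u y -> g y = None.
    move=> uy; rewrite H2 // /label orbb; case: eqP => // E.
    by rewrite E up_irr in uy.
  split=> // [y /N->//|].
  rewrite add0n; apply: eq_bigr => v cv; rewrite rep_none // => y /(child_bag cv).
  by rewrite /f; case: eqP => //= _ /N.
have Pext x a : extends u p q x a ->
    let l := label x a u in let f := fun y => if y == u then l else g y in
    [/\ forall b : V, l = Some b -> b = u \/ e u b,
        forall y, up u y -> compat u l y (g y) &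
        gain M u x a = is_leaf u l + \sum_(v | child u v) M v (rep f v).1 (rep f v).2].
  case/and3P=> bx ea /eqP E l f.
  have gE y : up u y -> g y = label x a y.
    by move=> uy; rewrite H2 // -(@restrict_label u x a y) // E.
  split.
  - move=> b; rewrite /l /label; case: eqVneq => [->|_] /=.
      by case=> <-; case/orP: ea => [/eqP->|]; [left|right].
    by case: eqVneq => [->|//] [->]; left.
  - move=> y uy; have nyu : y != u by apply: contraTneq uy => ->; rewrite up_irr.
    rewrite gE // /l /label; case: (eqVneq u x) => [Ex|nux] /=.
      rewrite -Ex (negPf nyu) /=; case: (eqVneq y a) => [->|] /=; first by rewrite eqxx orbT.
      by rewrite eq_sym.
    case: (eqVneq u a) => [Ea|nua] /=.
      by rewrite -Ea (negPf nyu) orbF; case: eqP => /= _; rewrite ?eqxx // eq_sym.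
    by case: ifP => //= _; rewrite eq_sym.
  - rewrite /gain; congr (_ + _).
      rewrite /l /label; case: (eqVneq u x) => [->|_] //=.
      by case: (eqVneq u a) => [->|_] //=; rewrite eqxx.
    apply: eq_bigr => v cv; rewrite (@rep_restrict f v x a) // => y /(child_bag cv).
    by rewrite /f; case: eqP => [->//|_] /= /gE.
have [x [a Exa]] : exists x a, \max_x \max_a (if extends u p q x a then gain M u x a else 0)
    = if extends u p q x a then gain M u x a else 0.
  have V0 : 0 < #|V| by apply/card_gt0P; exists u.
  have [x ->] := eq_bigmax (fun x => \max_a if extends u p q x a then gain M u x a else 0) V0.
  have [a ->] := eq_bigmax (fun a => if extends u p q x a then gain M u x a else 0) V0.
  by exists x, a.
(* A maximum of 0 need not come from an admissible candidate, 0 being also the default; but then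
   [(p, q)] itself, or the empty labelling, is admissible and has value 0. *)
case: (posnP (table_step M u p q)) => [E0|].
  case: H1 => [up_p|E].
    have ext : extends u p q p q.
      rewrite /extends up_p orbT /= /restrict up_p eqxx andbT.
      have [|->|->] := adj p q up_p; rewrite ?eqxx ?orbT //.
      by rewrite H2 // /label eqxx.
    exists (label p q u); have [? ? E] := Pext _ _ ext; split=> //.
    rewrite -E E0; apply/esym/eqP; rewrite -leqn0 -E0.
    apply: leq_trans (leq_maxr _ _); apply: leq_trans (leq_bigmax p).
    by apply: leq_trans (leq_bigmax q); rewrite ext.
  exists None; have [? ? E'] := Pnone E; split=> //.
  rewrite -E' E0; apply/esym/eqP; rewrite -leqn0 -E0.
  by apply: leq_trans (leq_maxl _ _); case: E => -> ->; rewrite eqxx.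
rewrite /table_step Exa; set A := (if _ && _ then _ else _).
have [_|_] := leqP A (if extends u p q x a then _ else _).
  case: ifP => // ext _; exists (label x a u); exact: Pext.
rewrite /A; case: ifP => // /andP[/eqP Ep /eqP Eq] _.
by exists None; apply: Pnone; rewrite Ep Eq.
Qed.

Variables (M : V -> V -> V -> nat) (n : nat).
Hypotheses (r_le : forall v, r v <= n) (r_onto : forall k, 0 < k <= n -> exists v, r v = k).
Hypothesis M_fix : forall u, M u =2 table_step M u.

(** The roots of the elimination forest on the vertices of rank at most [k]. *)
Definition pending (k : nat) (v : V) : bool :=
  (r v <= k) && ~~ [exists w, up v w && (r w <= k)].

Definition leaves_upto (k : nat) (f : V -> option V) : nat :=
  \sum_(v | r v <= k) is_leaf v (f v).

(** A pending [v] has no later neighbour of rank at most [k], so [u], if it is one, is the least. *)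
Lemma child_pending u k v : r u = k.+1 ->
  child u v = pending k v && up v u.
Proof.
move=> ru; rewrite /child /pending ru; apply/andP/andP => -[].
  move=> vu /existsPn H; split=> //; have := vu; rewrite /up ru ltnS => /andP[_ ->] /=.
  by apply/existsPn => w; have := H w; rewrite ltnS.
move=> /andP[_ /existsPn H] vu; split=> //.
by apply/existsPn => w; have := H w; rewrite ltnS.
Qed.

Lemma pendingS u k v : r u = k.+1 ->
  pending k.+1 v = (v == u) || (pending k v && ~~ up v u).
Proof.
move=> ru; rewrite /pending; case: (eqVneq v u) => [->|nvu] /=.
  rewrite ru leqnn; apply/existsPn => w; rewrite /up ru.
  by apply/negP => /andP[/andP[_ lt]]; rewrite leqNgt lt.
have -> : (r v <= k.+1) = (r v <= k).
  by rewrite leq_eqVlt -ru (inj_eq r_inj) (negPf nvu) ru.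
rewrite -andbA; congr (_ && _); rewrite -negb_or; congr (~~ _).
apply/existsP/orP => [[w /andP[vw]]|[/existsP[w /andP[vw rw]]|vu]].
- rewrite leq_eqVlt -{1}ru (inj_eq r_inj) => /orP[/eqP <-|rw]; first by right.
  by left; apply/existsP; exists w; rewrite vw.
- by exists w; rewrite vw leqW.
- by exists u; rewrite vu ru leqnn.
Qed.

(** [u] replaces its children among the roots; adding on both sides avoids truncated subtraction. *)
Lemma sum_pendingS u k (F : V -> nat) : r u = k.+1 ->
  \sum_(v | pending k.+1 v) F v + \sum_(v | child u v) F v =
  F u + \sum_(v | pending k v) F v.
Proof.
move=> ru; rewrite (bigD1 u) /=; last by rewrite (pendingS _ ru) eqxx.
rewrite -addnA; congr (_ + _).
rewrite [RHS](bigID (fun v => up v u)) /= addnC; congr (_ + _).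
  by apply: eq_bigl => v; rewrite (child_pending _ ru).
apply: eq_bigl => v; rewrite (pendingS _ ru); case: eqP => //= [->|_].
  by rewrite /pending ru ltnn.
by rewrite andbT.
Qed.

Lemma leaves_uptoS u k f : r u = k.+1 ->
  leaves_upto k.+1 f = is_leaf u (f u) + leaves_upto k f.
Proof.
move=> ru; rewrite /leaves_upto (bigD1 u) ?ru //=; congr (_ + _).
apply: eq_bigl => v; rewrite leq_eqVlt -ru (inj_eq r_inj) ru ltnS.
by case: eqP => //= [->|]; rewrite ?ru ?ltnn ?andbF ?andbT.
Qed.

Definition value (k : nat) (f : V -> option V) : nat :=
  \sum_(v | pending k v) M v (rep f v).1 (rep f v).2.

(* Together with value_attained: value k f is the largest number of leaves of
   rank at most k in a star labelling that agrees with f on higher ranks. *)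
Lemma leaves_le_value f k : star_labelling e f -> k <= n ->
  leaves_upto k f <= value k f.
Proof.
case=> adj ok; elim: k => [|k IH] kn.
  by rewrite /leaves_upto big_pred0 // => v; rewrite leqNgt r_gt0.
have [u ru] := r_onto (kn : 0 < k.+1 <= n).
rewrite (leaves_uptoS _ ru) -(leq_add2r (\sum_(v | child u v) M v (rep f v).1 (rep f v).2)).
rewrite /value (sum_pendingS _ ru) addnAC leq_add //; last exact: IH (ltnW kn).
rewrite M_fix; apply: table_step_ge => [x a _|x y _ _]; [exact: (adj x a)|exact: (ok x y)].
Qed.

(** The traceback: vertices are labelled by decreasing rank, each with the label supplied by
    [table_step_attained]. Nothing is assumed of [g] at ranks up to [k], where it is overwritten. *)
Lemma value_attained g k : k <= n ->
    (forall x a, k < r x -> g x = Some a -> a = x \/ e x a) ->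
    (forall x y, k < r x -> k < r y -> e x y -> compat x (g x) y (g y)) ->
  exists h, [/\ star_labelling e h, forall x, k < r x -> h x = g x &
                leaves_upto k h = value k g].
Proof.
elim: k g => [|k IH] g kn adj ok.
  exists g; split=> //; first by split=> [x a|x y exy]; [exact: adj|exact: ok].
  by rewrite /leaves_upto /value !big_pred0 // => v; rewrite /pending leqNgt r_gt0.
have [u ru] := r_onto (kn : 0 < k.+1 <= n).
have up_gt x : up u x -> k.+1 < r x by rewrite /up ru => /andP[].
have repr : represents g u (rep g u).
  have [N|[x [a [ux gx H]]]] := @clique_state (up u) g (@r_peo u)
      (fun x y ux uy => ok x y (up_gt x ux) (up_gt y uy)).
    rewrite rep_none //; apply/representsP; split; first by right.
    move=> y uy; rewrite N // /label orbb; case: eqP => // E.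
    by rewrite E up_irr in uy.
  rewrite (rep_restrict H); apply/representsP; split; first by rewrite /restrict ux; left.
  by move=> y uy; rewrite H // restrict_label.
have repr' : represents g u ((rep g u).1, (rep g u).2) by rewrite -surjective_pairing.
have [l] := table_step_attained M repr' (fun x a ux => adj x a (up_gt x ux)).
rewrite -M_fix; set g1 := fun y => _ => -[/= adjl okl Ml].
have g1u : g1 u = l by rewrite /g1 eqxx.
have g1E x : x != u -> g1 x = g x by rewrite /g1 => /negPf->.
have alive x : k < r x -> x != u -> k.+1 < r x.
  by move=> kx nxu; rewrite ltn_neqAle -ru (inj_eq r_inj) eq_sym nxu ru.
have nup x : e x u -> k < r x -> x != u -> up u x.
  by move=> exu kx nxu; rewrite /up e_sym exu ru alive.
have [||h [hV hE hv]] := IH g1 (ltnW kn).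
- move=> x a kx; case: (eqVneq x u) => [->|nx]; first by rewrite g1u; exact: adjl.
  by rewrite g1E //; apply/adj/alive.
- move=> x y kx ky exy; case: (eqVneq x u) => [Ex|nx].
    subst x; have ny : y != u by apply: contraTneq exy => ->; rewrite e_irr.
    by rewrite g1u g1E //; apply: okl; apply: nup => //; rewrite e_sym.
  case: (eqVneq y u) => [Ey|ny].
    by subst y; rewrite g1u g1E // compatC; apply/okl/nup.
  by rewrite !g1E //; apply: ok => //; apply: alive.
exists h; split=> //.
  move=> x kx; rewrite hE ?g1E //; last exact: ltnW.
  by apply: contraTneq kx => ->; rewrite ru ltnn.
rewrite (leaves_uptoS _ ru) hv hE ?ru // g1u.
(* Relabelling [u] does not change the trace seen by a root, as [u] is not among its later
   neighbours. *)
have Eg v : pending k.+1 v -> rep g v = rep g1 v.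
  case/andP=> _ /existsPn H; apply: rep_ext => y vy; rewrite g1E //.
  by have := H y; rewrite vy /=; apply: contraNneq => ->; rewrite ru.
have -> : value k.+1 g = value k.+1 g1 by apply: eq_bigr => v /Eg->.
apply/eqP; rewrite -(eqn_add2r (\sum_(v | child u v) M v (rep g1 v).1 (rep g1 v).2)).
rewrite {2}/value (sum_pendingS _ ru) -Eg; last by rewrite (pendingS _ ru) eqxx.
by rewrite Ml addnAC.
Qed.

(** At [k = n] a root has no later neighbour at all, so its only trace is empty, with code
    [(v, v)]. *)
Lemma sum_roots_eop : #|V| = n ->
  \sum_(v | ~~ [exists w, up v w]) M v v v = eop_number e.
Proof.
move=> Vn.
have Ev f : value n f = \sum_(v | ~~ [exists w, up v w]) M v v v.
  apply: eq_big => [v|v].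
    rewrite /pending r_le; congr (~~ _); apply: eq_existsb => w.
    by rewrite r_le andbT.
  case/andP=> _ /existsPn H; rewrite rep_none // => y vy.
  by have := H y; rewrite vy r_le.
have El f : leaves_upto n f = #|leaves f|.
  rewrite /leaves_upto -sum1_card [RHS]big_mkcond /=.
  by apply: eq_big => v; [rewrite r_le|rewrite inE; case: is_leaf].
apply: eop_numberE => // [f fV|].
  by rewrite -(Ev f) -El; exact: leaves_le_value.
have [|||h [hV _ hv]] := @value_attained (fun=> None) n => //.
by exists h => //; rewrite -El hv Ev.
Qed.

End Elimination.

(** * Compiling bounded loop programs *)

(** [MulDim] is the only product: addressing arrays of side [n] needs no other. *)
Inductive expr : Type :=
| Var of nat
| Cst of nat
| Dim
| Add of expr & expr
| Diff of expr & expr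
| MulDim of expr
| Fetch of expr
| Ite of expr & expr & expr
| Sum of nat & expr
| Max of nat & expr.

Inductive command : Type :=
| Store of expr & expr
| Then of command & command
| For of nat & command.

Section Semantics.
Variable n : nat.

Fixpoint eval (env mem : nat -> nat) (x : expr) : nat :=
  match x with
  | Var i => env i
  | Cst k => k
  | Dim => n
  | Add x y => eval env mem x + eval env mem y
  | Diff x y => eval env mem x - eval env mem y
  | MulDim x => eval env mem x * n
  | Fetch x => mem (eval env mem x)
  | Ite x y z => if eval env mem x == 0 then eval env mem z else eval env mem y
  | Sum i x => \sum_(k < n) eval (update env i k) mem x
  | Max i x => \max_(k < n) eval (update env i k) mem x
  end.

Fixpoint run (c : command) (env mem : nat -> nat) : nat -> nat :=
  match c with
  | Store a v => update mem (eval env mem a) (eval env mem v)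
  | Then c d => run d env (run c env mem)
  | For i c => foldl (fun m k => run c (update env i k) m) mem (iota 0 n)
  end.

End Semantics.

(* Register 0 keeps the dimension; variables live in odd registers and
   temporaries in the other even ones. *)
Definition vreg (i : nat) : nat := i.*2.+1.
Definition treg (j : nat) : nat := j.*2.+2.

Definition Move (i j : nat) : program := Seq (Const i 0) (Plus i i j).

(** Temporaries [j], [j + 1] and [j + 2] hold the saved value of the loop variable, the counter, and
    the number of rounds left, which the loop tests. *)
Definition Repeat (j i : nat) (body : program) : program :=
  Seq (Move (treg j) (vreg i))
  (Seq (Const (treg j.+1) 0)
  (Seq (Minus (treg j.+2) 0 (treg j.+1))
  (Seq (While (treg j.+2)
          (Seq (Move (vreg i) (treg j.+1))
          (Seq body
          (Seq (Const (treg j.+2) 1)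
          (Seq (Plus (treg j.+1) (treg j.+1) (treg j.+2))
               (Minus (treg j.+2) 0 (treg j.+1)))))))
       (Move (vreg i) (treg j))))).

(** The value is left in temporary [j], and lower temporaries survive. In [Sum] and [Max] the loop
    control takes [j + 1] to [j + 3]. Multiplication is repeated addition, with variable 0 as a
    dummy loop variable that [Repeat] restores. *)
Fixpoint compile_expr (x : expr) (j : nat) : program :=
  match x with
  | Var i => Move (treg j) (vreg i)
  | Cst k => Const (treg j) k
  | Dim => Move (treg j) 0
  | Add x y => Seq (compile_expr x j)
                 (Seq (compile_expr y j.+1) (Plus (treg j) (treg j) (treg j.+1)))
  | Diff x y => Seq (compile_expr x j)
                 (Seq (compile_expr y j.+1) (Minus (treg j) (treg j) (treg j.+1)))
  | MulDim x =>
      Seq (compile_expr x j.+1)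
        (Seq (Const (treg j) 0)
             (Repeat j.+2 0 (Plus (treg j) (treg j) (treg j.+1))))
  | Fetch x => Seq (compile_expr x j) (Read (treg j) (treg j))
  | Ite x y z =>
      Seq (compile_expr x j) (If (treg j) (compile_expr y j) (compile_expr z j))
  | Sum i x =>
      Seq (Const (treg j) 0)
        (Repeat j.+1 i (Seq (compile_expr x j.+4)
                            (Plus (treg j) (treg j) (treg j.+4))))
  | Max i x =>
      Seq (Const (treg j) 0)
        (Repeat j.+1 i (Seq (compile_expr x j.+4)
          (* max a b = a + (b - a) *)
          (Seq (Minus (treg j.+4) (treg j.+4) (treg j))
               (Plus (treg j) (treg j) (treg j.+4)))))
  end.

Fixpoint compile (c : command) (j : nat) : program :=
  match c with
  | Store a v => Seq (compile_expr a j)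
                   (Seq (compile_expr v j.+1) (Write (treg j) (treg j.+1)))
  | Then c d => Seq (compile c j) (compile d j)
  | For i c => Repeat j i (compile c j.+3)
  end.

(** Upper bounds, kept polynomial in [n] by charging both branches of a conditional. A loop whose
    body costs [b] is charged [n * (b + 7) + 8]; [Max] adds 2 to its body, whence the 9 that [Sum]
    shares. *)
Fixpoint expr_cost (n : nat) (x : expr) : nat :=
  match x with
  | Var _ | Cst _ | Dim => 2
  | Add x y | Diff x y => expr_cost n x + expr_cost n y + 1
  | MulDim x => expr_cost n x + n * 8 + 9
  | Fetch x => expr_cost n x + 1
  | Ite x y z => expr_cost n x + expr_cost n y + expr_cost n z + 1
  | Sum _ x | Max _ x => n * (expr_cost n x + 9) + 9
  end.

Fixpoint cost (n : nat) (c : command) : nat :=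
  match c with
  | Store a v => expr_cost n a + expr_cost n v + 1
  | Then c d => cost n c + cost n d
  | For _ c => n * (cost n c + 7) + 8
  end.

Definition polynomial (f : nat -> nat) : Prop :=
  exists q : {poly nat}, forall n, f n = q.[n]%R.

Lemma polynomial_const k : polynomial (fun=> k).
Proof. by exists (k%:P)%R => n; rewrite hornerC. Qed.

Lemma polynomial_id : polynomial id.
Proof. by exists 'X%R => n; rewrite hornerX. Qed.

Lemma polynomialD f g : polynomial f -> polynomial g -> polynomial (fun n => f n + g n).
Proof. by case=> p fp [q gq]; exists (p + q)%R => n; rewrite hornerD fp gq. Qed.

Lemma polynomialM f g : polynomial f -> polynomial g -> polynomial (fun n => f n * g n).
Proof. by case=> p fp [q gq]; exists (p * q)%R => n; rewrite hornerM fp gq. Qed.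

Lemma polynomial_expr_cost x : polynomial (expr_cost^~ x).
Proof.
elim: x => /=; intros; repeat first
  [ assumption | apply: polynomial_const | apply: polynomial_id
  | apply: polynomialD | apply: polynomialM ].
Qed.

Lemma polynomial_cost c : polynomial (cost^~ c).
Proof.
elim: c => /=; intros; repeat first
  [ assumption | apply: polynomial_const | apply: polynomial_id
  | apply: polynomial_expr_cost | apply: polynomialD | apply: polynomialM ].
Qed.

(** * Total correctness with a time bound *)

Definition halts (p : program) (s : state) (b : nat) (Q : state -> Prop) : Prop :=
  exists t s', [/\ exec p s t s', t <= b & Q s'].

Lemma halts_weaken p s b b' (Q Q' : state -> Prop) :
  halts p s b Q -> b <= b' -> (forall s', Q s' -> Q' s') -> halts p s b' Q'.
Proof.
case=> t [s' [ex le Qs]] bb QQ; exists t, s'; split=> //; last exact: QQ.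
exact: leq_trans le bb.
Qed.

Lemma halts_seq p q s b1 b2 (Q1 Q2 : state -> Prop) :
  halts p s b1 Q1 -> (forall s', Q1 s' -> halts q s' b2 Q2) ->
  halts (Seq p q) s (b1 + b2) Q2.
Proof.
case=> t1 [s1 [ex1 le1 H1]] /(_ s1 H1)[t2 [s2 [ex2 le2 H2]]].
by exists (t1 + t2), s2; split=> //; [apply: exec_seq ex1 ex2|apply: leq_add].
Qed.

Lemma halts_const i k s (Q : state -> Prop) :
  Q (set_reg s i k) -> halts (Const i k) s 1 Q.
Proof. by move=> H; exists 1, (set_reg s i k); split=> //; constructor. Qed.

Lemma halts_plus i j k s (Q : state -> Prop) :
  Q (set_reg s i (reg s j + reg s k)) -> halts (Plus i j k) s 1 Q.
Proof.
by move=> H; exists 1, (set_reg s i (reg s j + reg s k)); split=> //; constructor.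
Qed.

Lemma halts_minus i j k s (Q : state -> Prop) :
  Q (set_reg s i (reg s j - reg s k)) -> halts (Minus i j k) s 1 Q.
Proof.
by move=> H; exists 1, (set_reg s i (reg s j - reg s k)); split=> //; constructor.
Qed.

Lemma halts_move i j s (Q : state -> Prop) : i != j ->
  (forall s', reg s' i = reg s j -> (forall k, k != i -> reg s' k = reg s k) ->
     memory s' = memory s -> Q s') ->
  halts (Move i j) s 2 Q.
Proof.
move=> nij H; exists 2; eexists; split=> //; first exact: exec_seq (exec_const _ _ _) (exec_plus _ _ _ _).
apply: H => [|k /negPf nk|//]; rewrite /= /update; last by rewrite nk.
by rewrite !eqxx eq_sym (negPf nij).
Qed.

Lemma treg_eq j k : (treg j == treg k) = (j == k).
Proof. by rewrite /treg; lia. Qed.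
Lemma vreg_eq j k : (vreg j == vreg k) = (j == k).
Proof. by rewrite /vreg; lia. Qed.
Lemma treg_vreg j k : (treg j == vreg k) = false.
Proof. by rewrite /treg /vreg; lia. Qed.
Lemma vreg_treg j k : (vreg j == treg k) = false.
Proof. by rewrite /treg /vreg; lia. Qed.

Definition reg_eqE :=
  (treg_eq, vreg_eq, treg_vreg, vreg_treg,
   (fun j => erefl : (treg j == 0) = false), (fun j => erefl : (0 == treg j) = false),
   (fun j => erefl : (vreg j == 0) = false), (fun j => erefl : (0 == vreg j) = false)).

Definition agrees (n : nat) (env : nat -> nat) (s : state) : Prop :=
  reg s 0 = n /\ forall i, reg s (vreg i) = env i.

Definition keeps (j : nat) (s s' : state) : Prop :=
  forall k, k < j -> reg s' (treg k) = reg s (treg k).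

Lemma keeps_trans j s s' s'' : keeps j s s' -> keeps j s' s'' -> keeps j s s''.
Proof. by move=> H H' k kj; rewrite H' // H. Qed.

Lemma keepsW i j s s' : i <= j -> keeps j s s' -> keeps i s s'.
Proof. by move=> ij H k ki; apply: H; apply: leq_trans ij. Qed.

Lemma agrees_treg n env s j v : agrees n env s -> agrees n env (set_reg s (treg j) v).
Proof.
by case=> H0 H; split=> [|i]; rewrite /= /update reg_eqE.
Qed.

Lemma keeps_treg i j s v : i <= j -> keeps i s (set_reg s (treg j) v).
Proof. by move=> ij k ki; rewrite /= /update reg_eqE; case: eqP => //; lia. Qed.

(** [G k] is the invariant after [k] rounds. It may depend only on the memory and on temporaries
    below [j], so the bookkeeping of the loop preserves it. *)
Lemma halts_repeat j i body n env b (G : nat -> state -> Prop) s :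
    agrees n env s ->
    (forall k s s', memory s' = memory s -> keeps j s s' -> G k s -> G k s') ->
    (forall k s, k < n -> agrees n (update env i k) s -> G k s ->
       halts body s b (fun s' =>
         [/\ agrees n (update env i k) s',
             forall l, j <= l < j.+3 -> reg s' (treg l) = reg s (treg l) & G k.+1 s'])) ->
    G 0 s ->
  halts (Repeat j i body) s (n * (b + 7) + 8)
        (fun s' => agrees n env s' /\ G n s').
Proof.
move=> [H0 Hv] Gext Hbody G0.
pose Inv k s := [/\ reg s 0 = n, forall l, l != i -> reg s (vreg l) = env l,
  reg s (treg j) = env i & reg s (treg j.+1) = k /\ G k s].
(* [d] is the number of rounds left; a round takes [b + 5] units and its test one more, and the
   final 1 is the failing test. *)
have loop d k s1 : k + d = n -> reg s1 (treg j.+2) = d -> Inv k s1 ->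
    halts (While (treg j.+2)
          (Seq (Move (vreg i) (treg j.+1))
          (Seq body
          (Seq (Const (treg j.+2) 1)
          (Seq (Plus (treg j.+1) (treg j.+1) (treg j.+2))
               (Minus (treg j.+2) 0 (treg j.+1))))))) s1 (d * (b + 6) + 1) (Inv n).
  elim: d k s1 => [|d IH] k s1 kd sd I1.
    by exists 1, s1; split=> //; [exact: exec_while_stop|rewrite -kd addn0].
  have kn : k < n by lia.
  case: I1 => I0 Iv Is [Ik IG].
  have [t [s2 [ex le [sd2 I2]]]] : halts (Seq (Move (vreg i) (treg j.+1))
          (Seq body
          (Seq (Const (treg j.+2) 1)
          (Seq (Plus (treg j.+1) (treg j.+1) (treg j.+2))
               (Minus (treg j.+2) 0 (treg j.+1)))))) s1 (2 + (b + (1 + (1 + 1))))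
     (fun s2 => reg s2 (treg j.+2) = d /\ Inv k.+1 s2).
    apply: (halts_seq (Q1 := fun s2 => [/\ agrees n (update env i k) s2, keeps j.+3 s1 s2 & G k s2])).
      apply: halts_move => [|s2 E1 E2 Em]; first by rewrite reg_eqE.
      have K : keeps j.+3 s1 s2 by move=> l _; rewrite E2 // reg_eqE.
      split=> //; last by apply: Gext IG => //; apply: keepsW K; lia.
      split; first by rewrite E2.
      move=> l; rewrite /update; case: eqVneq => [->|nl]; first by rewrite E1.
      by rewrite E2 ?reg_eqE // Iv.
    move=> s2 [A2 K2 G2]; apply: (halts_seq (Hbody k s2 kn A2 G2)).
    move=> s3 [[A30 A3] K3 G3].
    have K13 l : j <= l < j.+3 -> reg s3 (treg l) = reg s1 (treg l).
      by move=> lj; rewrite K3 // K2 //; case/andP: lj.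
    apply: (halts_seq (Q1 := fun s4 => s4 = set_reg s3 (treg j.+2) 1)); first exact: halts_const.
    move=> _ ->; apply: (halts_seq (Q1 := fun s4 => s4 = set_reg (set_reg s3 (treg j.+2) 1) (treg j.+1) k.+1)).
      apply: halts_plus; rewrite /= /update !reg_eqE eqxx.
      have -> : (j.+1 == j.+2) = false by lia.
      by rewrite K13 ?Ik ?addn1 //; lia.
    move=> _ ->; apply: halts_minus; rewrite /= /update !reg_eqE !eqxx.
    split; first by rewrite A30; lia.
    split; rewrite /= /update ?reg_eqE ?eqxx //.
    - by move=> l nl; rewrite !reg_eqE A3 /update (negPf nl).
    - have -> : (j == j.+2) = false by lia.
      have -> : (j == j.+1) = false by lia.
      by rewrite K13 //; lia.
    - have -> : (j.+1 == j.+2) = false by lia.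
      split=> //; apply: Gext G3 => // l lj; rewrite /= /update !reg_eqE.
      by repeat (case: eqP; first lia).
  have [t' [s3 [ex' le' I3]]] := IH k.+1 s2 (etrans (addSnnS _ _) kd) sd2 I2.
  exists (t + t').+1, s3; split=> //; last by rewrite mulSn; lia.
  by apply: exec_while_step ex ex'; rewrite sd.
apply: (@halts_weaken _ _ (2 + (1 + (1 + ((n * (b + 6) + 1) + 2)))) _ (fun s' => agrees n env s' /\ G n s')) => //; last by lia.
apply: (halts_seq (Q1 := fun s1 => [/\ agrees n env s1, reg s1 (treg j) = env i & G 0 s1])).
  apply: halts_move => [|s1 E1 E2 Em]; first by rewrite reg_eqE.
  split; last by apply: Gext G0 => // l lj; rewrite E2 // reg_eqE; lia.
    by split=> [|l]; rewrite E2 // reg_eqE.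
  by rewrite E1.
move=> s1 [[A0 A] S1 G1].
apply: (halts_seq (Q1 := fun s2 => Inv 0 s2)).
  apply: halts_const; split=> //=; rewrite /update ?reg_eqE ?eqxx //.
  - by move=> l _; rewrite reg_eqE.
  - by case: eqP => //; lia.
  - split=> //; apply: Gext G1 => //; apply: keeps_treg; lia.
move=> s2 [I0 Iv Is [Ik IG]].
apply: (halts_seq (Q1 := fun s3 => reg s3 (treg j.+2) = n /\ Inv 0 s3)).
  apply: halts_minus; rewrite I0 Ik subn0 /= /update eqxx; split=> //; split=> //=;
    rewrite /update ?reg_eqE //.
  - by move=> l nl; rewrite reg_eqE Iv.
  - by case: eqP => //; lia.
  - split; first by case: eqP => //; lia.
    by apply: Gext IG => //; apply: keeps_treg; lia.
move=> s3 [d3 I3]; apply: (halts_seq (loop n 0 s3 (add0n n) d3 I3)).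
move=> s4 [J0 Jv Js [Jk JG]]; apply: halts_move => [|s5 E1 E2 Em]; first by rewrite reg_eqE.
split; last by apply: Gext JG => // l _; rewrite E2 // reg_eqE.
split; first by rewrite E2.
move=> l; case: (eqVneq l i) => [->|nl]; first by rewrite E1.
by rewrite E2 ?reg_eqE // Jv.
Qed.

Definition computes (p : program) (j n b : nat) (env mem : nat -> nat) (v : nat) : Prop :=
  forall s, agrees n env s -> memory s = mem ->
    halts p s b (fun s' => [/\ agrees n env s', keeps j s s', memory s' = mem &
                               reg s' (treg j) = v]).

Lemma computes_binary (f : nat -> nat -> nat) (op : nat -> nat -> nat -> program)
    p q j n b c env mem v w :
  (forall i k l s Q, Q (set_reg s i (f (reg s k) (reg s l))) -> halts (op i k l) s 1 Q) ->
  computes p j n b env mem v -> computes q j.+1 n c env mem w ->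
  computes (Seq p (Seq q (op (treg j) (treg j) (treg j.+1)))) j n (b + c + 1) env mem (f v w).
Proof.
move=> Hop Hp Hq s A M; rewrite -addnA; apply: (halts_seq (Hp s A M)).
move=> s1 [A1 K1 M1 V1]; apply: (halts_seq (Hq s1 A1 M1)) => s2 [A2 K2 M2 V2].
apply: Hop; split=> //; first exact: agrees_treg.
  apply: keeps_trans (keeps_trans K1 (keepsW (leqnSn j) K2)) _; exact: keeps_treg.
by rewrite /= /update eqxx V2 K2 // V1.
Qed.

(* The running value of a big operator is held in temporary j, its summand is
   computed in temporary j + 4. *)
Lemma computes_big (f : nat -> nat -> nat) p q i j n b c env mem F :
  (forall k, k < n -> computes p j.+4 n b (update env i k) mem (F k)) ->
  (forall s (Q : state -> Prop),
    (forall s', memory s' = memory s ->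
       reg s' (treg j) = f (reg s (treg j)) (reg s (treg j.+4)) ->
       (forall l, l != treg j -> l != treg j.+4 -> reg s' l = reg s l) -> Q s') ->
    halts q s c Q) ->
  computes (Seq (Const (treg j) 0) (Repeat j.+1 i (Seq p q))) j n
           (n * (b + c + 7) + 9) env mem (foldl f 0 [seq F k | k <- iota 0 n]).
Proof.
move=> Hp Hq s A M.
have -> : n * (b + c + 7) + 9 = 1 + (n * (b + c + 7) + 8) by lia.
apply: (halts_seq (Q1 := fun s1 => s1 = set_reg s (treg j) 0)); first exact: halts_const.
move=> _ ->; pose G k s' := [/\ keeps j s s', memory s' = mem &
  reg s' (treg j) = foldl f 0 [seq F l | l <- iota 0 k]].
apply: halts_weaken (leqnn _) _; first apply: (@halts_repeat j.+1 i (Seq p q) n env (b + c) G).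
- exact: agrees_treg.
- move=> k s1 s2 M12 K12 [K1 M1 V1]; split; last by rewrite K12.
    by apply: keeps_trans K1 (keepsW _ K12).
  by rewrite M12.
- move=> k s1 kn A1 [K1 M1 V1]; apply: (halts_seq (Hp k kn s1 A1 M1)).
  move=> s2 [A2 K2 M2 V2]; apply: Hq => s3 M3 V3 E3; split.
  + by split=> [|l]; rewrite E3 ?reg_eqE //; case: A2.
  + by move=> l lj; rewrite E3 ?reg_eqE ?K2 //; lia.
  + have jj : j < j.+4 by lia.
    split; last by rewrite V3 V2 K2 // V1 -addn1 iotaD map_cat foldl_cat.
      apply: keeps_trans (keeps_trans K1 (keepsW _ K2)) _; first by lia.
      by move=> l lj; rewrite E3 // reg_eqE; lia.
    by rewrite M3.
- by split; rewrite //= ?/update ?eqxx //; exact: keeps_treg.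
- by move=> s' [A' [K' M' V']]; split.
Qed.

Lemma foldl_sum (F : nat -> nat) n :
  foldl addn 0 [seq F k | k <- iota 0 n] = \sum_(k < n) F k.
Proof.
elim: n => [|n IH]; first by rewrite big_ord0.
by rewrite -addn1 iotaD map_cat foldl_cat IH addn1 big_ord_recr.
Qed.

Lemma foldl_max (F : nat -> nat) n :
  foldl maxn 0 [seq F k | k <- iota 0 n] = \max_(k < n) F k.
Proof.
elim: n => [|n IH]; first by rewrite big_ord0.
by rewrite -addn1 iotaD map_cat foldl_cat IH addn1 big_ord_recr.
Qed.

Lemma compile_exprP x j n env mem :
  computes (compile_expr x j) j n (expr_cost n x) env mem (eval n env mem x).
Proof.
elim: x j env => [i|k||x IHx y IHy|x IHx y IHy|x IHx|x IHx|x IHx y IHy z IHz|i x IHx|i x IHx] j env /=.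
- move=> s A M; apply: halts_move => [|s' E1 E2 M']; first by rewrite reg_eqE.
  split; rewrite ?M' //; last by rewrite E1; case: A.
    by split=> [|l]; rewrite E2 ?reg_eqE //; case: A.
  by move=> l lj; rewrite E2 // reg_eqE; lia.
- move=> s A M; apply: halts_weaken (leqnSn 1) (fun _ => id); apply: halts_const.
  by split; rewrite /= ?/update ?eqxx //; [exact: agrees_treg|exact: keeps_treg].
- move=> s A M; apply: halts_move => [|s' E1 E2 M']; first by rewrite reg_eqE.
  split; rewrite ?M' //; last by rewrite E1; case: A.
    by split=> [|l]; rewrite E2 ?reg_eqE //; case: A.
  by move=> l lj; rewrite E2 // reg_eqE; lia.
- by apply: (computes_binary (f := addn)) => // *; apply: halts_plus.
- by apply: (computes_binary (f := subn)) => // *; apply: halts_minus.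
- move=> s A M; rewrite -addnA; apply: (halts_seq (IHx j.+1 env s A M)).
  move=> s1 [A1 K1 M1 V1]; set v := eval n env mem x in V1 *.
  have -> : n * 8 + 9 = 1 + (n * (1 + 7) + 8) by lia.
  apply: (halts_seq (Q1 := fun s2 => s2 = set_reg s1 (treg j) 0)); first exact: halts_const.
  move=> _ ->; pose G k s' := [/\ keeps j s s', memory s' = mem, reg s' (treg j) = v * k &
                               reg s' (treg j.+1) = v].
  apply: halts_weaken (leqnn _) _; first apply: (@halts_repeat j.+2 0 _ n env 1 G).
  + exact: agrees_treg.
  + move=> k s2 s3 M23 K23 [K2 M2 V2 W2]; split; rewrite ?M23 ?K23 //.
    by apply: keeps_trans K2 (keepsW _ K23); lia.
  + move=> k s2 kn A2 [K2 M2 V2 W2]; apply: halts_plus; split.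
    * exact: agrees_treg.
    * by move=> l lj; rewrite /= /update reg_eqE; case: eqP => //; lia.
    * have nj : (j.+1 == j) = false by lia.
      split; rewrite /= /update ?reg_eqE ?nj ?eqxx //; last by rewrite V2 W2 mulnSr.
      by apply: keeps_trans K2 _; apply: keeps_treg.
  + have nj : (j.+1 == j) = false by lia.
    split; rewrite /= /update ?reg_eqE ?nj ?eqxx ?muln0 //.
    by apply: keeps_trans (keepsW _ K1) _; last exact: keeps_treg.
  + by move=> s' [A' [K' M' V' _]]; split.
- move=> s A M; apply: (halts_seq (IHx j env s A M)) => s1 [A1 K1 M1 V1].
  exists 1, (set_reg s1 (treg j) (memory s1 (reg s1 (treg j)))); split=> //.
    exact: exec_read.
  split; rewrite /= /update ?eqxx ?M1 ?V1 //; first exact: agrees_treg.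
  by apply: keeps_trans K1 _; apply: keeps_treg.
- move=> s A M.
  have -> : expr_cost n x + expr_cost n y + expr_cost n z + 1 =
            expr_cost n x + (expr_cost n y + expr_cost n z + 1) by lia.
  apply: (halts_seq (IHx j env s A M)) => s1 [A1 K1 M1 V1].
  case: ifP => /eqP E.
    have [t [s' [ex le [A' K' M' V']]]] := IHz j env s1 A1 M1.
    exists t.+1, s'; split; [|lia|split=> //; exact: keeps_trans K1 K'].
    by apply: exec_if_zero ex; rewrite V1.
  have [t [s' [ex le [A' K' M' V']]]] := IHy j env s1 A1 M1.
  exists t.+1, s'; split; [|lia|split=> //; exact: keeps_trans K1 K'].
  by apply: exec_if_nonzero ex; rewrite V1.
- rewrite -(foldl_sum (fun k => eval n (update env i k) mem x)) => s A M.
  have H := computes_big (f := addn) (q := Plus (treg j) (treg j) (treg j.+4)) (c := 1)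
    (fun k _ => IHx j.+4 (update env i k)).
  apply: halts_weaken (H _ s A M) _ (fun _ => id); last by lia.
  move=> s1 Q HQ; apply: halts_plus; apply: HQ; rewrite /= /update ?eqxx //.
  by move=> l /negPf->.
- rewrite -(foldl_max (fun k => eval n (update env i k) mem x)) => s A M.
  have H := computes_big (f := maxn)
    (q := Seq (Minus (treg j.+4) (treg j.+4) (treg j)) (Plus (treg j) (treg j) (treg j.+4)))
    (c := 2) (fun k _ => IHx j.+4 (update env i k)).
  apply: halts_weaken (H _ s A M) _ (fun _ => id); last by lia.
  move=> s1 Q HQ; apply: (@halts_seq _ _ _ 1 1 (fun s2 => s2 = set_reg s1 (treg j.+4)
     (reg s1 (treg j.+4) - reg s1 (treg j)))); first exact: halts_minus.
  move=> _ ->; apply: halts_plus; have nj : (j == j.+4) = false by lia.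
  apply: HQ; rewrite /= /update ?reg_eqE ?nj ?eqxx //; first by rewrite maxnE.
  by move=> l /negPf-> /negPf->.
Qed.

Lemma compileP c j n env s : agrees n env s ->
  halts (compile c j) s (cost n c) (fun s' =>
    [/\ agrees n env s', keeps j s s' & memory s' = run n c env (memory s)]).
Proof.
elim: c j env s => [x y|c IHc d IHd|i c IHc] j env s A /=.
- rewrite -addnA; apply: (halts_seq (compile_exprP x j A erefl)).
  move=> s1 [A1 K1 M1 V1]; apply: (halts_seq (compile_exprP y j.+1 A1 erefl)).
  move=> s2 [A2 K2 M2 V2].
  exists 1, (set_mem s2 (reg s2 (treg j)) (reg s2 (treg j.+1))); split=> //.
    exact: exec_write.
  split=> //; first exact: keeps_trans K1 (keepsW (leqnSn j) K2).
  by rewrite /= V2 K2 // V1 M2 M1.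
- apply: (halts_seq (IHc j env s A)) => s1 [A1 K1 M1].
  apply: halts_weaken (IHd j env s1 A1) (leqnn _) _ => s2 [A2 K2 M2].
  by split=> //; [exact: keeps_trans K1 K2|rewrite M2 M1].
- pose G k s' := keeps j s s' /\
    memory s' = foldl (fun m k => run n c (update env i k) m) (memory s) (iota 0 k).
  apply: halts_weaken (leqnn _) _; first apply: (@halts_repeat j i _ n env (cost n c) G) => //.
  + move=> k s1 s2 M12 K12 [K1 M1]; split; last by rewrite M12.
    exact: keeps_trans K1 K12.
  + move=> k s1 kn A1 [K1 M1]; apply: halts_weaken (IHc j.+3 _ _ A1) (leqnn _) _.
    move=> s2 [A2 K2 M2]; split=> //; first by move=> l /andP[_ lj]; apply: K2.
    split; first by apply: keeps_trans K1 (keepsW _ K2); lia.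
    by rewrite M2 M1 -[k.+1]addn1 iotaD foldl_cat.
  + by move=> s' [A' [K' M']].
Qed.

Definition algorithm (c : command) (x : expr) : program :=
  Seq (compile c 0) (Seq (compile_expr x 0) (Move 0 (treg 0))).

Lemma algorithmP c x : exists q : {poly nat}, forall n m, exists t s',
  [/\ exec (algorithm c x) (State (input_regs n) m) t s',
      output s' = eval n (fun=> 0) (run n c (fun=> 0) m) x & t <= q.[n]%R].
Proof.
have [q qE] : polynomial (fun n => cost n c + (expr_cost n x + 2)).
  by apply/polynomialD; [exact: polynomial_cost|
     apply/polynomialD; [exact: polynomial_expr_cost|exact: polynomial_const]].
exists q => n m; rewrite -qE; set s := State _ m.
have A : agrees n (fun=> 0) s by [].
have [] : halts (algorithm c x) s (cost n c + (expr_cost n x + 2))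
   (fun s' => output s' = eval n (fun=> 0) (run n c (fun=> 0) m) x).
  apply: (halts_seq (compileP c 0 A)) => s1 [A1 _ M1].
  apply: (halts_seq (compile_exprP x 0 A1 M1)) => s2 [A2 _ M2 V2].
  by apply: halts_move => // s3 E _ _; rewrite /output E V2.
by move=> t [s' [ex le E]]; exists t, s'.
Qed.

(** * The algorithm *)

(** Truth values are 0 and 1; comparisons rest on truncated subtraction vanishing exactly when the
    first number is at most the second. *)
Definition Not (x : expr) : expr := Diff (Cst 1) x.
Definition And (x y : expr) : expr := Ite x y (Cst 0).
Definition Or (x y : expr) : expr := Ite x (Cst 1) y.
Definition Lt (x y : expr) : expr := Not (Diff (Add x (Cst 1)) y).
Definition Eq (x y : expr) : expr := Not (Add (Diff x y) (Diff y x)).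
Definition Maxn (x y : expr) : expr := Add x (Diff y x).

(** Digits in base [n] below an unbounded tag [k]. For [k = i = 0] the address is [j * n + l], so
    the input matrix is used where it stands. *)
Definition addr (n k i j l : nat) : nat := ((k * n + i) * n + j) * n + l.

Definition Addr (k i j l : expr) : expr :=
  Add (MulDim (Add (MulDim (Add (MulDim k) i)) j)) l.

(* The adjacency matrix is found at tag 0, the elimination ranks (0 for the
   vertices not yet eliminated) at tag 1, and table k at tag k + 2. *)
Definition Adj (x y : expr) : expr := Fetch (Addr (Cst 0) (Cst 0) x y).
Definition Rank (x : expr) : expr := Fetch (Addr (Cst 1) (Cst 0) (Cst 0) x).
Definition Tab (k v p q : expr) : expr := Fetch (Addr (Add k (Cst 2)) v p q).

Definition t_ := Var 0. Definition u_ := Var 1. Definition p_ := Var 2.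
Definition q_ := Var 3. Definition x_ := Var 4. Definition a_ := Var 5.
Definition v_ := Var 6. Definition w_ := Var 7.

Definition Up (v w : expr) : expr := And (Adj v w) (Lt (Rank v) (Rank w)).

Definition Child : expr :=
  And (Up v_ u_) (Not (Max 7 (And (Up v_ w_) (Lt (Rank w_) (Rank u_))))).

Definition Restrict1 (v : expr) : expr := Ite (Up v x_) x_ (Ite (Up v a_) a_ v).
Definition Restrict2 (v : expr) : expr := Ite (Up v x_) a_ (Ite (Up v a_) a_ v).

Definition Extends : expr :=
  And (Or (Eq x_ u_) (Up u_ x_))
      (And (Or (Eq a_ x_) (Adj x_ a_))
           (And (Eq (Restrict1 u_) p_) (Eq (Restrict2 u_) q_))).

Definition Gain : expr :=
  Add (And (Eq x_ u_) (Not (Eq a_ x_)))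
      (Sum 6 (Ite Child (Tab t_ v_ (Restrict1 v_) (Restrict2 v_)) (Cst 0))).

Definition Gain0 : expr := Sum 6 (Ite Child (Tab t_ v_ v_ v_) (Cst 0)).

Definition TableStep : expr :=
  Maxn (Ite (And (Eq p_ u_) (Eq q_ u_)) Gain0 (Cst 0))
       (Max 4 (Max 5 (Ite Extends Gain (Cst 0)))).

Definition Alive (v : expr) : expr := Eq (Rank v) (Cst 0).

Definition Simplicial : expr :=
  And (Alive u_)
    (Not (Max 4 (Max 5
      (And (And (Alive x_) (Adj u_ x_))
           (And (And (Alive a_) (Adj u_ a_))
                (And (Not (Eq x_ a_)) (Not (Adj x_ a_)))))))).

(** A search is written as a maximum, which yields the largest simplicial vertex among those left.
    The default 0 does no harm, as chordality guarantees that some vertex qualifies. *)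
Definition rank_loop : command :=
  For 0 (Store (Addr (Cst 1) (Cst 0) (Cst 0) (Max 1 (Ite Simplicial u_ (Cst 0))))
               (Add t_ (Cst 1))).

(** Round [t] reads the table at tag [t + 2] and writes at tag [t + 3], so reading and writing do
    not interfere. *)
Definition table_loop : command :=
  For 0 (For 1 (For 2 (For 3 (Store (Addr (Add t_ (Cst 3)) u_ p_ q_) TableStep)))).

Definition Answer : expr :=
  Sum 6 (Ite (Max 7 (Up v_ w_)) (Cst 0) (Tab Dim v_ v_ v_)).

Lemma addr_eq n k k' i i' j j' l l' :
  i < n -> i' < n -> j < n -> j' < n -> l < n -> l' < n ->
  (addr n k i j l == addr n k' i' j' l') = [&& k == k', i == i', j == j' & l == l'].
Proof.
have digit a b c d : b < n -> d < n -> (a * n + b == c * n + d) = (a == c) && (b == d).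
  move=> bn dn; apply/eqP/andP => [E|[/eqP-> /eqP->] //].
  have n0 : 0 < n by apply: leq_ltn_trans bn.
  have := congr1 (divn^~ n) E; have := congr1 (modn^~ n) E.
  by rewrite !modnMDl !modn_small // !divnMDl // !divn_small // !addn0 => -> ->.
by move=> *; rewrite /addr !digit // -!andbA.
Qed.

Lemma eq_nat_of_bool_max n (P : pred 'I_n) : \max_(k < n) (P k : nat) = [exists k, P k].
Proof.
apply/eqP; rewrite eqn_leq; apply/andP; split.
  apply/bigmax_leqP => k _; case Pk: (P k) => //.
  by have -> : [exists k, P k] by apply/existsP; exists k.
by case: existsP => // -[k Pk]; apply: leq_trans (leq_bigmax k); rewrite Pk.
Qed.

(** * Evaluation in a memory that holds the graph, the ranks and a table *)

Section Evaluation.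
Variables (n : nat) (mem : nat -> nat).

Lemma eval_not (env : nat -> nat) x (b : bool) : eval n env mem x = b -> eval n env mem (Not x) = ~~ b.
Proof. by move=> /= ->; case: b. Qed.

Lemma eval_and (env : nat -> nat) x y (b c : bool) : eval n env mem x = b -> eval n env mem y = c ->
  eval n env mem (And x y) = b && c.
Proof. by move=> /= -> ->; case: b; case: c. Qed.

Lemma eval_or (env : nat -> nat) x y (b c : bool) : eval n env mem x = b -> eval n env mem y = c ->
  eval n env mem (Or x y) = b || c.
Proof. by move=> /= -> ->; case: b; case: c. Qed.

Lemma eval_lt (env : nat -> nat) x y i j : eval n env mem x = i -> eval n env mem y = j ->
  eval n env mem (Lt x y) = (i < j).
Proof. by move=> /= -> ->; lia. Qed.

Lemma eval_eq (env : nat -> nat) x y i j : eval n env mem x = i -> eval n env mem y = j ->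
  eval n env mem (Eq x y) = (i == j).
Proof. by move=> /= -> ->; lia. Qed.

Lemma eval_ite (env : nat -> nat) x y z (b : bool) i j : eval n env mem x = b ->
  eval n env mem y = i -> eval n env mem z = j ->
  eval n env mem (Ite x y z) = if b then i else j.
Proof. by move=> /= -> -> ->; case: b. Qed.

Lemma eval_sum (env : nat -> nat) i x (F : 'I_n -> nat) :
  (forall k : 'I_n, eval n (update env i k) mem x = F k) ->
  eval n env mem (Sum i x) = \sum_k F k.
Proof. by move=> H; apply: eq_bigr. Qed.

Lemma eval_max (env : nat -> nat) i x (F : 'I_n -> nat) :
  (forall k : 'I_n, eval n (update env i k) mem x = F k) ->
  eval n env mem (Max i x) = \max_k F k.
Proof. by move=> H; apply: eq_bigr. Qed.

Lemma eval_exists (env : nat -> nat) i x (P : pred 'I_n) :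
  (forall k : 'I_n, eval n (update env i k) mem x = P k) ->
  eval n env mem (Max i x) = [exists k, P k].
Proof. by rewrite -eq_nat_of_bool_max; apply: eval_max. Qed.

Variables (e : rel 'I_n) (r : 'I_n -> nat) (t : nat) (M : 'I_n -> 'I_n -> 'I_n -> nat).
Hypothesis mem_adj : forall i j : 'I_n, mem (addr n 0 0 i j) = e i j.
Hypothesis mem_rank : forall i : 'I_n, mem (addr n 1 0 0 i) = r i.

Lemma eval_adj (env : nat -> nat) x y (i j : 'I_n) :
  eval n env mem x = i -> eval n env mem y = j -> eval n env mem (Adj x y) = e i j.
Proof. by move=> /= -> ->; rewrite mem_adj. Qed.

Lemma eval_rank (env : nat -> nat) x (i : 'I_n) :
  eval n env mem x = i -> eval n env mem (Rank x) = r i.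
Proof. by move=> /= ->; rewrite mem_rank. Qed.

Lemma eval_up (env : nat -> nat) x y (i j : 'I_n) : eval n env mem x = i -> eval n env mem y = j ->
  eval n env mem (Up x y) = up e r i j.
Proof.
by move=> Hi Hj; apply: eval_and; [apply: eval_adj|apply: eval_lt; apply: eval_rank].
Qed.

Lemma eval_child (env : nat -> nat) (u v : 'I_n) : env 1 = u -> env 6 = v ->
  eval n env mem Child = child e r u v.
Proof.
move=> Hu Hv; apply: eval_and; first exact: eval_up.
apply/eval_not/eval_exists => w; apply: eval_and; first exact: eval_up.
by apply: eval_lt; apply: eval_rank.
Qed.

Lemma eval_restrict (env : nat -> nat) z (v x a : 'I_n) :
    eval n env mem z = v -> env 4 = x -> env 5 = a ->
  eval n env mem (Restrict1 z) = (restrict e r v x a).1 /\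
  eval n env mem (Restrict2 z) = (restrict e r v x a).2.
Proof.
move=> Hv; rewrite -[env 4]/(eval n env mem x_) -[env 5]/(eval n env mem a_) => Hx Ha.
have Hvx := eval_up Hv Hx; have Hva := eval_up Hv Ha.
rewrite /restrict; split.
  by rewrite (eval_ite Hvx Hx (eval_ite Hva Ha Hv)); case: ifP => //; case: ifP.
by rewrite (eval_ite Hvx Ha (eval_ite Hva Ha Hv)); case: ifP => //; case: ifP.
Qed.

Lemma eval_simplicial (env : nat -> nat) (u : 'I_n) : env 1 = u ->
  eval n env mem Simplicial =
  (r u == 0) && ~~ [exists x, exists y, ((r x == 0) && e u x) &&
     (((r y == 0) && e u y) && ((x != y) && ~~ e x y))].
Proof.
move=> Hu; have alive env' z (w : 'I_n) : eval n env' mem z = w ->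
    eval n env' mem (Alive z) = (r w == 0).
  by move=> Hw; apply: eval_eq => //; apply: eval_rank.
apply: eval_and; first exact: alive.
apply/eval_not/eval_exists => x; apply/eval_exists => a.
apply: eval_and; first by apply: eval_and; [exact: alive|exact: eval_adj].
apply: eval_and; first by apply: eval_and; [exact: alive|exact: eval_adj].
by apply: eval_and; apply: eval_not; [exact: eval_eq|exact: eval_adj].
Qed.

Hypothesis mem_table : forall v p q : 'I_n, mem (addr n (t + 2) v p q) = M v p q.

Lemma eval_tab (env : nat -> nat) k x y z (v p q : 'I_n) : eval n env mem k = t ->
    eval n env mem x = v -> eval n env mem y = p -> eval n env mem z = q ->
  eval n env mem (Tab k x y z) = M v p q.
Proof. by move=> /= -> -> -> ->; rewrite mem_table. Qed.

Lemma eval_extends (env : nat -> nat) (u p q x a : 'I_n) :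
    env 1 = u -> env 2 = p -> env 3 = q -> env 4 = x -> env 5 = a ->
  eval n env mem Extends = extends e r u p q x a.
Proof.
move=> Hu Hp Hq Hx Ha; apply: eval_and.
  by apply: eval_or; [exact: eval_eq|exact: eval_up].
apply: eval_and; first by apply: eval_or; [exact: eval_eq|exact: eval_adj].
have [R1 R2] := eval_restrict (Hu : eval n env mem u_ = u) Hx Ha.
case: (restrict e r u x a) R1 R2 => i j R1 R2; rewrite xpair_eqE.
by apply: eval_and; exact: eval_eq.
Qed.

Lemma eval_gain (env : nat -> nat) (u x a : 'I_n) :
    env 0 = t -> env 1 = u -> env 4 = x -> env 5 = a ->
  eval n env mem Gain = gain e r M u x a.
Proof.
move=> Ht Hu Hx Ha.
have E : eval n env mem (And (Eq x_ u_) (Not (Eq a_ x_))) = (x == u) && (a != x).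
  by apply: eval_and; [exact: eval_eq|apply/eval_not/eval_eq].
have E' : eval n env mem (Sum 6 (Ite Child (Tab t_ v_ (Restrict1 v_) (Restrict2 v_)) (Cst 0)))
    = \sum_(v | child e r u v) M v (restrict e r v x a).1 (restrict e r v x a).2.
  rewrite [RHS]big_mkcond; apply: eval_sum => v.
  set env' := update env 6 v; have Hv : eval n env' mem v_ = v by [].
  have [R1 R2] := @eval_restrict env' v_ v x a Hv Hx Ha.
  by apply: eval_ite; [exact: eval_child|exact: eval_tab|].
by rewrite /gain -E -E'.
Qed.

Lemma eval_gain0 (env : nat -> nat) (u : 'I_n) : env 0 = t -> env 1 = u ->
  eval n env mem Gain0 = gain0 e r M u.
Proof.
move=> Ht Hu; rewrite [RHS]big_mkcond; apply: eval_sum => v.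
by apply: eval_ite; [exact: eval_child|exact: eval_tab|].
Qed.

Lemma eval_table_step (env : nat -> nat) (u p q : 'I_n) :
    env 0 = t -> env 1 = u -> env 2 = p -> env 3 = q ->
  eval n env mem TableStep = table_step e r M u p q.
Proof.
move=> Ht Hu Hp Hq; rewrite /table_step maxnE.
have E0 : eval n env mem (Ite (And (Eq p_ u_) (Eq q_ u_)) Gain0 (Cst 0)) =
    if (p == u) && (q == u) then gain0 e r M u else 0.
  by apply: eval_ite; [apply: eval_and; exact: eval_eq|exact: eval_gain0|].
have E1 : eval n env mem (Max 4 (Max 5 (Ite Extends Gain (Cst 0)))) =
    \max_x \max_a if extends e r u p q x a then gain e r M u x a else 0.
  apply: eval_max => x; apply: eval_max => a.
  by apply: eval_ite; [exact: eval_extends|exact: eval_gain|].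
by rewrite -E0 -E1.
Qed.

Lemma eval_answer : t = n -> eval n (fun=> 0) mem Answer =
  \sum_(v | ~~ [exists w, up e r v w]) M v v v.
Proof.
move=> tn; rewrite [RHS]big_mkcond; apply: eval_sum => v; rewrite if_neg.
apply: eval_ite => //; last by apply: eval_tab; rewrite /= ?tn.
by apply: eval_exists => w; apply: eval_up.
Qed.

End Evaluation.

Lemma run_for n i c env (I : nat -> (nat -> nat) -> Prop) m :
  I 0 m -> (forall k m, k < n -> I k m -> I k.+1 (run n c (update env i k) m)) ->
  I n (run n (For i c) env m).
Proof.
move=> I0 IS /=; suff H k : k <= n ->
    I k (foldl (fun m k => run n c (update env i k) m) m (iota 0 k)) by exact: H.
elim: k => [//|k IH] kn; rewrite -addn1 iotaD foldl_cat addn1 /=.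
exact: IS (IH (ltnW kn)).
Qed.

Lemma graph_input_addr n (e : rel 'I_n) k (i j l : 'I_n) :
  memory (graph_input e) (addr n k i j l) = [&& k == 0, i == 0 :> nat & e j l].
Proof.
have n0 : 0 < n by apply: leq_ltn_trans (ltn_ord i).
congr nat_of_bool; apply/existsP/idP => [[x /existsP[y /andP[]]]|/and3P[/eqP-> /eqP-> ejl]].
  rewrite -[_ + _]/(addr n 0 0 x y) addr_eq //.
  by case/and4P=> -> -> /eqP/val_inj-> /eqP/val_inj->.
by exists j; apply/existsP; exists l; rewrite ejl eqxx.
Qed.

(** * Invariants of the ranking and table loops *)

Section Loops.
Variables (n : nat) (e : rel 'I_n).
Hypotheses (e_sym : symmetric e) (e_irr : irreflexive e) (e_chordal : chordal e).

(** A perfect elimination order in progress: a vertex of rank 0 is not yet eliminated and counts as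
    later than every ranked one. *)
Definition ranked (t : nat) (r : 'I_n -> nat) : Prop :=
  [/\ forall v, r v <= t,
      forall k, 0 < k <= t -> exists v, r v = k,
      forall v w, 0 < r v -> r v = r w -> v = w,
      #|[set v | r v == 0]| = n - t &
      forall v x y, 0 < r v -> e v x -> (r x == 0) || (r v < r x) ->
        e v y -> (r y == 0) || (r v < r y) -> x != y -> e x y].

(** The last condition provides table 0, at tag 2: the memory is initially zero there. *)
Definition rank_inv (t : nat) (mem : nat -> nat) : Prop :=
  exists r : 'I_n -> nat,
  [/\ ranked t r,
      forall i j : 'I_n, mem (addr n 0 0 i j) = e i j,
      forall i : 'I_n, mem (addr n 1 0 0 i) = r i &
      forall i j l : 'I_n, mem (addr n 2 i j l) = 0].

Lemma rank_step t mem (env : nat -> nat) : t < n -> env 0 = t -> rank_inv t mem ->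
  rank_inv t.+1 (run n (Store (Addr (Cst 1) (Cst 0) (Cst 0) (Max 1 (Ite Simplicial u_ (Cst 0))))
               (Add t_ (Cst 1))) env mem).
Proof.
move=> tn Ht [r [[r_le r_onto r_inj r_card r_peo] mem_adj mem_rank mem_tab]].
have n0 : 0 < n by apply: leq_ltn_trans tn.
pose A := [set v | r v == 0].
pose bad u := [exists x, exists y, ((r x == 0) && e u x) &&
     (((r y == 0) && e u y) && ((x != y) && ~~ e x y))].
have A0 : A != set0 by rewrite -card_gt0 r_card subn_gt0.
have [w wA wsimp] := simplicial_vertex e_sym e_irr e_chordal A0.
have good_w : (r w == 0) && ~~ bad w.
  move: wA; rewrite inE => -> /=; apply/existsPn => x; apply/existsPn => y.
  apply/negP => /and3P[/andP[rx ewx] /andP[ry ewy] /andP[nxy /negP]]; apply.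
  by apply: wsimp; rewrite ?inE.
have [u good_u Hu] : exists2 u : 'I_n, (r u == 0) && ~~ bad u &
    eval n env mem (Max 1 (Ite Simplicial u_ (Cst 0))) = u.
  have -> : eval n env mem (Max 1 (Ite Simplicial u_ (Cst 0))) =
      \max_(u | (r u == 0) && ~~ bad u) u.
    rewrite [RHS]big_mkcond; apply: eval_max => u.
    by apply: eval_ite => //; apply: (eval_simplicial mem_adj mem_rank).
  have [|u gu ->] := @eq_bigmax_cond _ [pred u | (r u == 0) && ~~ bad u] (@nat_of_ord n).
    by apply/card_gt0P; exists w.
  by exists u.
case/andP: good_u => /eqP ru0 /existsPn ngood.
exists (fun v => if v == u then t.+1 else r v).
have -> : run n (Store (Addr (Cst 1) (Cst 0) (Cst 0) (Max 1 (Ite Simplicial u_ (Cst 0))))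
    (Add t_ (Cst 1))) env mem = update mem (addr n 1 0 0 u) t.+1.
  rewrite -Hu -[t.+1]addn1 -Ht; congr update.
split.
- split.
  + by move=> v; case: eqP => // _; apply: leqW.
  + move=> k /andP[k0]; rewrite leq_eqVlt => /orP[/eqP->|kt].
      by exists u; rewrite eqxx.
    have [|v rv] := r_onto k; first by rewrite k0.
    by exists v; case: eqP => // E; rewrite -rv E ru0 in k0.
  + move=> v w'; case: eqP => [->|_]; case: eqP => [->|_] // v0 E.
    * by have := r_le w'; rewrite -E ltnn.
    * by have := r_le v; rewrite E ltnn.
    * exact: r_inj.
  + have -> : [set v | (if v == u then t.+1 else r v) == 0] = A :\ u.
      by apply/setP => v; rewrite !inE; case: (v == u).
    by have := cardsD1 u A; rewrite inE ru0 eqxx r_card add1n => E; rewrite subnS E.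
  + move=> v x y; case: (eqVneq v u) => [-> _|nvu v0].
      move=> eux; case: (eqVneq x u) => [Ex|nxu]; first by rewrite Ex e_irr in eux.
      (* Earlier ranks are at most [t], so only unranked neighbours are later than [u]. *)
      rewrite ltnNge (leqW (r_le x)) orbF => rx euy.
      case: (eqVneq y u) => [Ey|nyu]; first by rewrite Ey e_irr in euy.
      rewrite ltnNge (leqW (r_le y)) orbF => ry nxy.
      have /existsPn/(_ y) := ngood x.
      by rewrite rx ry eux euy nxy /= negbK.
    (* A vertex ranked before gains no later neighbour: [u] already counted as later while
       unranked. *)
    have keep z : ((if z == u then t.+1 else r z) == 0) ||
        (r v < (if z == u then t.+1 else r z)) -> (r z == 0) || (r v < r z).
      by case: (eqVneq z u) => [->|_] //; rewrite ru0.
    by move=> evx /keep rx evy /keep ry; apply: r_peo rx evy ry.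
- by move=> i j; rewrite /= /update addr_eq //= mem_adj.
- move=> i; rewrite /= /update addr_eq //= mem_rank.
  by rewrite -val_eqE.
- by move=> i j l; rewrite /= /update addr_eq //= mem_tab.
Qed.

Lemma rank_loop_correct : rank_inv n (run n rank_loop (fun=> 0) (memory (graph_input e))).
Proof.
apply: (run_for (I := rank_inv)).
  exists (fun=> 0); split=> //.
  - split=> //; first by move=> k; case: k.
    by rewrite subn0 -[RHS]card_ord -cardsT; apply: eq_card => v; rewrite !inE.
  - by move=> i j; have n0 : 0 < n := leq_ltn_trans (leq0n _) (ltn_ord i);
      rewrite (graph_input_addr e 0 (Ordinal n0)).
  - by move=> i; have n0 : 0 < n := leq_ltn_trans (leq0n _) (ltn_ord i);
      rewrite (graph_input_addr e 1 (Ordinal n0) (Ordinal n0)).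
  - by move=> i j l; rewrite graph_input_addr.
by move=> t m tn; apply: rank_step.
Qed.

Section Tables.
Variables (r : 'I_n -> nat).

Definition table_inv (t : nat) (mem : nat -> nat) : Prop :=
  [/\ forall i j : 'I_n, mem (addr n 0 0 i j) = e i j,
      forall i : 'I_n, mem (addr n 1 0 0 i) = r i &
      forall v p q : 'I_n, mem (addr n (t + 2) v p q) = table e r t v p q].

(* The entries of table t + 1 are filled in lexicographic order. *)
Definition partial_inv (t N : nat) (mem : nat -> nat) : Prop :=
  table_inv t mem /\ forall v p q : 'I_n, addr n 0 v p q < N ->
    mem (addr n (t + 3) v p q) = table e r t.+1 v p q.

Lemma table_entry t mem (env : nat -> nat) (v p q : 'I_n) :
    env 0 = t -> env 1 = v -> env 2 = p -> env 3 = q ->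
  partial_inv t (addr n 0 v p q) mem ->
  partial_inv t (addr n 0 v p q).+1
    (run n (Store (Addr (Add t_ (Cst 3)) u_ p_ q_) TableStep) env mem).
Proof.
move=> Ht Hv Hp Hq [[mem_adj mem_rank mem_tab] filled].
have n0 : 0 < n by apply: leq_ltn_trans (ltn_ord v).
have -> : run n (Store (Addr (Add t_ (Cst 3)) u_ p_ q_) TableStep) env mem =
    update mem (addr n (t + 3) v p q) (table e r t.+1 v p q).
  by rewrite /= -(eval_table_step mem_adj mem_rank mem_tab Ht Hv Hp Hq) -Ht -Hv -Hp -Hq.
have tag k : k < t + 3 -> (k == t + 3) = false by move=> /ltn_eqF.
split; first split.
- by move=> i j; rewrite /update addr_eq // tag ?mem_adj //; lia.
- by move=> i; rewrite /update addr_eq // tag ?mem_rank //; lia.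
- by move=> v' p' q'; rewrite /update addr_eq // tag ?mem_tab //; lia.
move=> v' p' q' lt; rewrite /update addr_eq // eqxx /=.
case: ifP => [/and3P[/eqP/val_inj-> /eqP/val_inj-> /eqP/val_inj->]//|ne].
apply: filled; rewrite ltn_neqAle -ltnS lt andbT addr_eq // eqxx /=.
by rewrite ne.
Qed.

Lemma table_loop_correct mem : table_inv 0 mem -> table_inv n (run n table_loop (fun=> 0) mem).
Proof.
move=> inv0; apply: (@run_for n 0 _ (fun=> 0) table_inv mem) => // t m tn inv.
suff [[mem_adj mem_rank _] tab] : partial_inv t (n * n * n)
    (run n (For 1 (For 2 (For 3 (Store (Addr (Add t_ (Cst 3)) u_ p_ q_) TableStep))))
       (update (fun=> 0) 0 t) m).
  split=> // v p q; rewrite addSnnS tab // /addr mul0n add0n.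
  have vn : v * n + p < n * n.
    by apply: leq_trans (leq_mul (ltn_ord v) (leqnn n)); rewrite mulSn addnC ltn_add2r.
  by apply: leq_trans (leq_mul vn (leqnn n)); rewrite mulSn addnC ltn_add2r.
(* Each loop counts the filled entries as the address of the next one with inner digits 0; a
   completed inner loop carries into the digit above. *)
apply: (run_for (I := fun k => partial_inv t (k * n * n))); first by split.
move=> u m1 un inv1.
have -> : u.+1 * n * n = (u * n + n) * n by rewrite mulSnr.
apply: (run_for (I := fun k => partial_inv t ((u * n + k) * n))); first by rewrite addn0.
move=> p m2 pn inv2; rewrite addnS mulSnr.
apply: (run_for (I := fun k => partial_inv t ((u * n + p) * n + k))); first by rewrite addn0.
move=> q m3 qn inv3; rewrite addnS.
by have := @table_entry t m3
  (update (update (update (update (fun=> 0) 0 t) 1 u) 2 p) 3 q)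
  (Ordinal un) (Ordinal pn) (Ordinal qn) erefl erefl erefl erefl; rewrite /addr /=; apply.
Qed.

End Tables.

Lemma algorithm_correct :
  eval n (fun=> 0) (run n (Then rank_loop table_loop) (fun=> 0) (memory (graph_input e))) Answer
  = eop_number e.
Proof.
have [r [[r_le r_onto r_inj r_card r_peo] mem_adj mem_rank mem_tab]] := rank_loop_correct.
have r_gt0 v : 0 < r v.
  rewrite lt0n; have := in_set0 v; rewrite -(cards0_eq (etrans r_card (subnn n))) inE.
  by move->.
have [adj rank tab] := table_loop_correct (And3 mem_adj mem_rank mem_tab).
apply: etrans (eval_answer adj rank tab erefl) _.
apply: (sum_roots_eop r_gt0 e_sym e_irr _ _ r_le r_onto); last by rewrite card_ord.
- by move=> v w; apply: r_inj.
- move=> v x y /andP[evx rx] /andP[evy ry]; apply: (r_peo v) => //.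
    by rewrite rx orbT.
  by rewrite ry orbT.
- by move=> u; apply: table_fixpoint.
Qed.

End Loops.

Theorem theorem15 :
  exists (f : nat -> nat) (q : {poly nat}) (p : program),
    computable f /\
    forall (n : nat) (e : rel 'I_n),
      symmetric e -> irreflexive e -> chordal e ->
      exists (t : nat) (s : state),
        [/\ exec p (graph_input e) t s,
            output s = eop_number e &
            t <= f (clique_number e) * q.[n]%R].
Proof.
have [q Hq] := algorithmP (Then rank_loop table_loop) Answer.
exists (fun=> 1), q, (algorithm (Then rank_loop table_loop) Answer); split.
  by exists (Const 0 1) => k; exists 1; eexists; split; first exact: exec_const.
move=> n e e_sym e_irr e_chordal.
have [t [s [ex out le]]] := Hq n (memory (graph_input e)).
exists t, s; split=> //; last by rewrite mul1n.
by rewrite out algorithm_correct.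
Qed.
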